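(* Let $R$ be a commutative Noetherian semiperfect ring, let $C$ be a semidualizing $R$-module, and let $M$ be a stable (finite) $R$-module such that $\mathrm{G}_C\text{-}\dim_R(M)=0$ and $\lambda M\in\mathcal{A}_C$. Then $M$ is horizontally linked, $\lambda M$ is a stable $R$-module, and $\mathrm{G}_C\text{-}\dim_R(\lambda M\otimes_R C)=0$.
   Context: A commutative Noetherian ring is semiperfect iff it is a finite direct product of local rings; over it every finite (= finitely generated) module has a projective cover. A finite $R$-module $C$ is semidualizing if the homothety map $R\to\mathrm{Hom}_R(C,C)$ is an isomorphism and $\mathrm{Ext}^i_R(C,C)=0$ for all $i>0$. Write $(-)^C=\mathrm{Hom}_R(-,C)$ and $(-)^*=\mathrm{Hom}_R(-,R)$. A finite module $X$ has $\mathrm{G}_C\text{-}\dim_R(X)=0$ iff it is totally $C$-reflexive, i.e. the biduality map $X\to X^{CC}$ is an isomorphism and $\mathrm{Ext}^i_R(X,C)=\mathrm{Ext}^i_R(X^C,C)=0$ for all $i>0$. If $P_1\xrightarrow{f}P_0\to M\to 0$ is a minimal projective presentation of a finite module $M$, $\mathrm{Tr}(M)=\mathrm{Coker}(f^*\colon P_0^*\to P_1^* )$, and $\lambda M=\Omega\,\mathrm{Tr}(M)$ is the kernel of a projective cover of $\mathrm{Tr}(M)$. $M$ is horizontally linked if $M\cong\lambda(\lambda M)$. A finite module is stable if it has no non-zero projective direct summand. The Auslander class $\mathcal{A}_C$ consists of all $R$-modules $N$ such that the natural map $N\to\mathrm{Hom}_R(C,N\otimes_R C)$ is an isomorphism and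 $\mathrm{Tor}^R_i(C,N)=0=\mathrm{Ext}^i_R(C,N\otimes_R C)$ for all $i>0$. *)

(* Defs.v *)
From HB Require Import structures.
From mathcomp Require Import all_boot all_order all_algebra.
From mathcomp Require Import generic_quotient ring_quotient.
From mathcomp Require Import boolp.
From mathcomp.multinomials Require Import freeg.

Set Implicit Arguments.
Unset Strict Implicit.
Unset Printing Implicit Defensive.

Import GRing.Theory.
Local Open Scope ring_scope.
Local Open Scope quotient_scope.

(* Modules over a commutative ring R are MathComp's lmodType R. A "finite"
   module is a finitely generated one. *)

Section Basics.
Variable R : comNzRingType.
Implicit Types U V W : lmodType R.

Definition finite_module V : Prop :=
  exists (n : nat) (g : 'I_n -> V),
    forall x, exists c : 'I_n -> R, x = \sum_i c i *: g i.

Definition isomorphic U V : Prop := exists f : {linear U -> V}, bijective f.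

Definition surjective U V (f : {linear U -> V}) : Prop :=
  forall y, exists x, f x = y.

Definition exact U V W (f : {linear U -> V}) (g : {linear V -> W}) : Prop :=
  forall y, g y = 0 <-> exists x, f x = y.

Definition is_kernel U V W (i : {linear U -> V}) (f : {linear V -> W}) : Prop :=
  injective i /\ exact i f.

Definition is_cokernel U V W (f : {linear U -> V}) (q : {linear V -> W}) : Prop :=
  surjective q /\ exact f q.

Definition projective (P : lmodType R) : Prop :=
  forall U V (g : {linear U -> V}) (f : {linear P -> V}),
    surjective g -> exists h : {linear P -> U}, g \o h =1 f.

Definition stable V : Prop :=
  finite_module V /\
  forall P Q : lmodType R,
    projective P -> isomorphic V (P * Q)%type -> forall x : P, x = 0.

End Basics.

Section Rings.

Definition noetherian (R : comNzRingType) : Prop :=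
  forall I : submodClosed R^o,
    exists (n : nat) (g : 'I_n -> R),
      (forall i, g i \in I) /\
      (forall x, x \in I -> exists c : 'I_n -> R, x = \sum_i c i * g i).

Definition maximal_ideal (R : comNzRingType) (m : submodClosed R^o) : Prop :=
  (1 : R) \notin m /\
  forall J : submodClosed R^o,
    {subset m <= J} -> (1 : R) \notin J -> {subset J <= m}.

Definition local_ring (R : comNzRingType) : Prop :=
  exists m : submodClosed R^o,
    maximal_ideal m /\ forall m', maximal_ideal m' -> m' =i m.

(* For commutative rings, semiperfect means: isomorphic to a finite direct
   product of local rings. MathComp has no ring structure on dependent
   products, so the isomorphism R -> \prod_i A_i is given by its components. *)
Definition semiperfect (R : comNzRingType) : Prop :=
  exists (n : nat) (A : 'I_n -> comNzRingType)
         (p : forall i, {rmorphism R -> A i}),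
    (forall i, local_ring (A i)) /\
    (forall a : (forall i, A i), exists! r, forall i, p i r = a i).

End Rings.

Section SubQuotient.
Variables (R : comNzRingType) (V : lmodType R).

Section Sub.
Variable W : submodClosed V.
Definition submodule : Type := {x : V | x \in W}.
HB.instance Definition _ := SubChoice.on submodule.
HB.instance Definition _ := [SubChoice_isSubLmodule of submodule by <:].
End Sub.

Section Span.
Variable S : V -> Prop.
Definition in_span : V -> bool := fun x =>
  `[< forall W : submodClosed V, (forall s, S s -> s \in W) -> x \in W >].

Lemma span_closed : subsemimod_closed in_span.
Proof.
split=> [|a x /asboolP xS].
  split=> [|x y /asboolP xS /asboolP yS].
    by apply/asboolP => W _; exact: rpred0.
  by apply/asboolP => W SW; rewrite rpredD ?xS ?yS.
by apply/asboolP => W SW; rewrite rpredZ ?xS.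
Qed.

HB.instance Definition _ := GRing.isSubmodClosed.Build R V in_span span_closed.
Definition span : submodClosed V := GRing.SubmodClosed.clone R V in_span _.
End Span.

Section Quotient.
Variable W : submodClosed V.

Definition zmod_of_submod : V -> bool := fun x => x \in W.
Lemma zmod_of_submod_closed : zmod_closed zmod_of_submod.
Proof.
split=> [|x y xW yW]; first exact: (rpred0 W).
by rewrite -scaleN1r; apply: rpredD => //; apply: rpredZ.
Qed.
HB.instance Definition _ :=
  GRing.isZmodClosed.Build V zmod_of_submod zmod_of_submod_closed.
Definition zmod_pred : zmodClosed V := GRing.ZmodClosed.clone V zmod_of_submod _.

Definition quotient : Type := ring_quotient.Quotient.quot zmod_pred.
HB.instance Definition _ := GRing.Zmodule.on quotient.

Definition quotient_pi (x : V) : quotient :=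
  \pi_(ring_quotient.Quotient.quot zmod_pred) x.

Definition quotient_scale (a : R) (u : quotient) : quotient :=
  quotient_pi (a *: repr u).

Lemma quotient_piP x y : quotient_pi x = quotient_pi y <-> x - y \in W.
Proof.
have := ring_quotient.Quotient.idealrBE zmod_pred x y.
by rewrite -[x - y \in W]/(x - y \in zmod_pred) => ->; split=> /eqP.
Qed.

Lemma quotient_pi_surj (u : quotient) : exists x, quotient_pi x = u.
Proof. by exists (repr u); rewrite /quotient_pi reprK. Qed.

Lemma quotient_piD x y : quotient_pi (x + y) = quotient_pi x + quotient_pi y.
Proof. by rewrite /quotient_pi !piE. Qed.

Lemma quotient_piZ a x : quotient_pi (a *: x) = quotient_scale a (quotient_pi x).
Proof.
apply/quotient_piP; rewrite -scalerBr rpredZ //.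
by apply/quotient_piP; rewrite /quotient_pi reprK.
Qed.

Lemma quotient_scaleA a b u :
  quotient_scale a (quotient_scale b u) = quotient_scale (a * b) u.
Proof.
by have [x <-] := quotient_pi_surj u; rewrite -!quotient_piZ scalerA.
Qed.

Lemma quotient_scale1 u : quotient_scale 1 u = u.
Proof.
by have [x <-] := quotient_pi_surj u; rewrite -!quotient_piZ scale1r.
Qed.

Lemma quotient_scaleDr a u v :
  quotient_scale a (u + v) = quotient_scale a u + quotient_scale a v.
Proof.
have [x <-] := quotient_pi_surj u; have [y <-] := quotient_pi_surj v.
by rewrite -quotient_piD -!quotient_piZ scalerDr quotient_piD.
Qed.

Lemma quotient_scaleDl u a b :
  quotient_scale (a + b) u = quotient_scale a u + quotient_scale b u.
Proof.
have [x <-] := quotient_pi_surj u.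
by rewrite -!quotient_piZ scalerDl quotient_piD.
Qed.

HB.instance Definition _ := GRing.Zmodule_isLmodule.Build R quotient
  quotient_scaleA quotient_scale1 quotient_scaleDr quotient_scaleDl.

Lemma quotient_pi_linear : linear quotient_pi.
Proof. by move=> a x y; rewrite quotient_piD quotient_piZ. Qed.
HB.instance Definition _ :=
  GRing.isLinear.Build R V quotient *:%R quotient_pi quotient_pi_linear.

Section Lift.
Variables (Y : lmodType R) (f : {linear V -> Y}).
Hypothesis fW : forall w, w \in W -> f w = 0.

Definition quotient_lift_fun (u : quotient) : Y := f (repr u).

Lemma quotient_lift_funE x : quotient_lift_fun (quotient_pi x) = f x.
Proof.
apply/eqP; rewrite -subr_eq0 -raddfB; apply/eqP/fW/quotient_piP.
by rewrite /quotient_pi reprK.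
Qed.

Lemma quotient_lift_fun_linear : linear quotient_lift_fun.
Proof.
move=> a u v; have [x <-] := quotient_pi_surj u; have [y <-] := quotient_pi_surj v.
by rewrite -quotient_pi_linear !quotient_lift_funE linearP.
Qed.

Definition quotient_lift : {linear quotient -> Y} :=
  HB.pack quotient_lift_fun
    (GRing.isLinear.Build R quotient Y *:%R quotient_lift_fun
       quotient_lift_fun_linear).
End Lift.

End Quotient.
End SubQuotient.

Section Kernel.
Variables (R : comNzRingType) (V Y : lmodType R) (f : {linear V -> Y}).
Definition in_kernel : V -> bool := fun x => f x == 0.
Lemma kernel_closed : subsemimod_closed in_kernel.
Proof.
split=> [|a x /eqP fx]; last by apply/eqP; rewrite linearZ_LR fx scaler0.
split=> [|x y /eqP fx /eqP fy]; apply/eqP; first by rewrite linear0.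
by rewrite linearD fx fy addr0.
Qed.
HB.instance Definition _ := GRing.isSubmodClosed.Build R V in_kernel kernel_closed.
Definition kernel : submodClosed V := GRing.SubmodClosed.clone R V in_kernel _.
Lemma kernelP x : reflect (f x = 0) (x \in kernel).
Proof. exact: eqP. Qed.
End Kernel.

Section Hom.
Variables (R : comNzRingType) (U V : lmodType R).

Definition hom : Type := {linear U -> V}.
Identity Coercion linear_of_hom : hom >-> GRing.Linear.type.

Lemma hom_ext (f g : hom) : f =1 g -> f = g.
Proof.
case: f g => [f [[af] [sf]]] [g [[ag] [sg]]] /= /funext fg.
move: af sf ag sg; rewrite /= fg => af sf ag sg.
by rewrite (Prop_irrelevance af ag) (Prop_irrelevance sf sg).
Qed.

HB.instance Definition _ := gen_eqMixin hom.
HB.instance Definition _ := gen_choiceMixin hom.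

Definition hom_zero : hom := \0%R.
Definition hom_opp (f : hom) : hom := \- f.
Definition hom_add (f g : hom) : hom := f \+ g.
Definition hom_scale (a : R) (f : hom) : hom := a \*: f.

Lemma hom_addA : associative hom_add.
Proof. by move=> f g h; apply: hom_ext => x /=; rewrite addrA. Qed.
Lemma hom_addC : commutative hom_add.
Proof. by move=> f g; apply: hom_ext => x /=; rewrite addrC. Qed.
Lemma hom_add0 : left_id hom_zero hom_add.
Proof. by move=> f; apply: hom_ext => x /=; rewrite add0r. Qed.
Lemma hom_addN : left_inverse hom_zero hom_opp hom_add.
Proof. by move=> f; apply: hom_ext => x /=; rewrite addNr. Qed.
HB.instance Definition _ :=
  GRing.isZmodule.Build hom hom_addA hom_addC hom_add0 hom_addN.

Lemma hom_scaleA a b f : hom_scale a (hom_scale b f) = hom_scale (a * b) f.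
Proof. by apply: hom_ext => x /=; rewrite scalerA. Qed.
Lemma hom_scale1 : left_id 1 hom_scale.
Proof. by move=> f; apply: hom_ext => x /=; rewrite scale1r. Qed.
Lemma hom_scaleDr : right_distributive hom_scale +%R.
Proof. by move=> a f g; apply: hom_ext => x /=; rewrite scalerDr. Qed.
Lemma hom_scaleDl f : {morph hom_scale^~ f : a b / a + b}.
Proof. by move=> a b; apply: hom_ext => x /=; rewrite scalerDl. Qed.
HB.instance Definition _ := GRing.Zmodule_isLmodule.Build R hom
  hom_scaleA hom_scale1 hom_scaleDr hom_scaleDl.

End Hom.

Section HomMaps.
Variable R : comNzRingType.

Section Precomposition.
Variables (U V Y : lmodType R) (f : {linear U -> V}).
(* Hom(f, Y) *)
Definition hom_pre (g : hom V Y) : hom U Y := g \o f.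
Lemma hom_pre_linear : linear hom_pre.
Proof. by move=> a g h; apply: hom_ext. Qed.
HB.instance Definition _ :=
  GRing.isLinear.Build R (hom V Y) (hom U Y) *:%R hom_pre hom_pre_linear.
End Precomposition.
Arguments hom_pre {U V} Y f g.

Section Homothety.
Variable C : lmodType R.
Definition homothety_fun (r : R^o) (x : C) : C := r *: x.
Lemma homothety_fun_linear r : linear (homothety_fun r).
Proof. by move=> a x y; rewrite /homothety_fun scalerDr !scalerA mulrC. Qed.
HB.instance Definition _ r :=
  GRing.isLinear.Build R C C *:%R (homothety_fun r) (homothety_fun_linear r).
Definition homothety (r : R^o) : hom C C := homothety_fun r.
End Homothety.

Section Biduality.
Variables (C X : lmodType R).
Definition biduality_fun (x : X) (f : hom X C) : C := f x.
Lemma biduality_fun_linear x : linear (biduality_fun x).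
Proof. by []. Qed.
HB.instance Definition _ x :=
  GRing.isLinear.Build R (hom X C) C *:%R (biduality_fun x)
    (biduality_fun_linear x).
Definition biduality (x : X) : hom (hom X C) C := biduality_fun x.
End Biduality.
End HomMaps.
Arguments hom_pre {R U V} Y f g.

Section FreeModule.
Variables (R : comNzRingType) (S : choiceType).

Definition free_module : lmodType R := {freeg S / R}.

Section Lift.
Variables (Y : lmodType R) (f : S -> Y).
Definition free_lift_fun : free_module -> Y := fglift f.

Lemma free_lift_funE k x : free_lift_fun << k *g x >> = k *: f x.
Proof. exact: liftU. Qed.

HB.instance Definition _ := GRing.isZmodMorphism.Build free_module Y
  free_lift_fun (@lift_is_additive R S Y f).

Lemma free_lift_fun_linear : linear free_lift_fun.
Proof.
have fD : {morph free_lift_fun : x y / x + y} by exact: raddfD.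
have f0 : free_lift_fun 0 = 0 by exact: raddf0.
move=> a D E; rewrite fD; congr (_ + _).
rewrite -[D in RHS]freeg_sumE -[a *: D]/(fgscale a D) /fgscale.
rewrite !(big_morph free_lift_fun fD f0) scaler_sumr.
by apply: eq_bigr => x _; rewrite !free_lift_funE scalerA.
Qed.

Definition free_lift : {linear free_module -> Y} :=
  HB.pack free_lift_fun
    (GRing.isLinear.Build R free_module Y *:%R free_lift_fun
       free_lift_fun_linear).
End Lift.

Lemma free_lift_ext (Y : lmodType R) (f g : {linear free_module -> Y}) :
  (forall x, f << x >> = g << x >>) -> f =1 g.
Proof.
move=> fg D; rewrite -[D]freeg_sumE !raddf_sum; apply: eq_bigr => x _ /=.
have -> : << coeff x D *g x >> = coeff x D *: (<< x >> : free_module).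
  by apply/eqP/freeg_eqP => y; rewrite coeffZ !coeffU mul1r.
by rewrite !linearZ fg.
Qed.

End FreeModule.

Section Tensor.
Variables (R : comNzRingType) (M N : lmodType R).

Local Notation F := (free_module R (M * N)%type).

Inductive tensor_relation : F -> Prop :=
| TensorRelL a x x' y : tensor_relation
    (<< (a *: x + x', y) >> - (a *: (<< (x, y) >> : F) + << (x', y) >>))
| TensorRelR a x y y' : tensor_relation
    (<< (x, a *: y + y') >> - (a *: (<< (x, y) >> : F) + << (x, y') >>)).

Definition tensor : lmodType R := quotient (span tensor_relation).

Definition tens (x : M) (y : N) : tensor :=
  quotient_pi (span tensor_relation) << (x, y) >>.

Lemma tens_linearl y : linear (tens^~ y).
Proof.
move=> a x x'; rewrite /tens -quotient_pi_linear.
by apply/quotient_piP/asboolP => W; apply; constructor.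
Qed.

Lemma tens_linearr x : linear (tens x).
Proof.
move=> a y y'; rewrite /tens -quotient_pi_linear.
by apply/quotient_piP/asboolP => W; apply; constructor.
Qed.

Lemma tensor_ext (Y : lmodType R) (f g : {linear tensor -> Y}) :
  (forall x y, f (tens x y) = g (tens x y)) -> f =1 g.
Proof.
move=> fg u; have [x <-] := quotient_pi_surj u; move: x.
apply: (@free_lift_ext _ _ _ (f \o quotient_pi (span tensor_relation))
  (g \o quotient_pi (span tensor_relation))) => -[x y]; exact: fg.
Qed.

Section Lift.
Variables (Y : lmodType R) (b : M -> N -> Y).
Hypothesis bl : forall y, linear (b^~ y).
Hypothesis br : forall x, linear (b x).

Let f := free_lift (fun xy : M * N => b xy.1 xy.2).

Let fE x y : f << (x, y) >> = b x y.
Proof. by rewrite /= free_lift_funE scale1r. Qed.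

Lemma tensor_lift_subproof w : w \in span tensor_relation -> f w = 0.
Proof.
move=> /asboolP /(_ (kernel f)) wf; apply/kernelP/wf => _ [a x x' y|a x y y'].
  by apply/kernelP; rewrite linearB linearP !fE bl subrr.
by apply/kernelP; rewrite linearB linearP !fE br subrr.
Qed.

Definition tensor_lift : {linear tensor -> Y} := quotient_lift tensor_lift_subproof.

Lemma tensor_liftE x y : tensor_lift (tens x y) = b x y.
Proof. by rewrite -fE; exact: (quotient_lift_funE tensor_lift_subproof). Qed.

End Lift.
End Tensor.

Section TensorMap.
Variables (R : comNzRingType) (M M' N : lmodType R) (f : {linear M -> M'}).

Let b (x : M) (y : N) : tensor M' N := tens (f x) y.
Let bl y : linear (b^~ y).
Proof. by move=> a x x'; rewrite /b linearP tens_linearl. Qed.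
Let br x : linear (b x).
Proof. by move=> a y y'; rewrite /b tens_linearr. Qed.

(* f \otimes N *)
Definition tensor_map : {linear tensor M N -> tensor M' N} := tensor_lift bl br.

Lemma tensor_mapE x y : tensor_map (tens x y) = tens (f x) y.
Proof. exact: tensor_liftE. Qed.
End TensorMap.
Arguments tensor_map {R M M'} N f.

Section TensorUnit.
Variables (R : comNzRingType) (C N : lmodType R).
HB.instance Definition _ (x : N) := GRing.isLinear.Build R C (tensor N C) *:%R
  (tens x) (@tens_linearr R N C x).
Definition tensor_unit (x : N) : hom C (tensor N C) := tens x.
End TensorUnit.

Section Homology.
Variable R : comNzRingType.

Record projective_resolution (X : lmodType R) := ProjectiveResolution {
  res_term :> nat -> lmodType R;
  res_diff : forall n, {linear res_term n.+1 -> res_term n};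
  res_aug : {linear res_term 0 -> X};
  res_projective : forall n, projective (res_term n);
  res_aug_surj : surjective res_aug;
  res_exact0 : exact (res_diff 0) res_aug;
  res_exact : forall n, exact (res_diff n.+1) (res_diff n)
}.

(* Ext^i_R(X, Y) = 0: the complex Hom(P_0, Y) -> Hom(P_1, Y) -> ... has no
   cohomology in degree i, for P a projective resolution of X. *)
Definition Ext_zero (i : nat) (X Y : lmodType R) : Prop :=
  forall P : projective_resolution X,
    match i with
    | 0 => injective (hom_pre Y (res_diff P 0))
    | n.+1 => exact (hom_pre Y (res_diff P n)) (hom_pre Y (res_diff P n.+1))
    end.

(* Tor_i^R(X, N) = 0: the complex ... -> P_1 (x) N -> P_0 (x) N has no
   homology in degree i, for P a projective resolution of X. *)
Definition Tor_zero (i : nat) (X N : lmodType R) : Prop :=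
  forall P : projective_resolution X,
    match i with
    | 0 => surjective (tensor_map N (res_diff P 0))
    | n.+1 => exact (tensor_map N (res_diff P n.+1)) (tensor_map N (res_diff P n))
    end.

Lemma free_module_projective (S : choiceType) : projective (free_module R S).
Proof.
move=> U V g f gs; pose h s := sval (cid (gs (f << s >>))).
exists (free_lift h); apply: (@free_lift_ext _ _ _ (g \o free_lift h)) => s /=.
by rewrite free_lift_funE scale1r; exact: svalP (cid (gs (f << s >>))).
Qed.

(* The quantification over resolutions in Ext_zero and Tor_zero is not
   vacuous. *)
Section Existence.
Variable X : lmodType R.

Definition free_cover (V : lmodType R) : {linear free_module R V -> V} :=
  free_lift id.

Lemma free_cover_surj V : surjective (free_cover V).
Proof. by move=> x; exists << x >>; rewrite /= free_lift_funE scale1r. Qed.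

Fixpoint syzygy (n : nat) : lmodType R :=
  if n is m.+1 then submodule (kernel (free_cover (syzygy m))) else X.

Let incl n : {linear syzygy n.+1 -> free_module R (syzygy n)} := val.

Lemma projective_resolution_exists : inhabited (projective_resolution X).
Proof.
have inclE n : exact (incl n \o free_cover (syzygy n.+1)) (free_cover (syzygy n)).
  move=> y; split=> [y0|[x <-]]; last by apply/kernelP; exact: valP.
  have yk : y \in kernel (free_cover (syzygy n)) by apply/kernelP.
  have [x xE] := free_cover_surj (Sub y yk : syzygy n.+1).
  by exists x; rewrite -[LHS]/(incl n (free_cover _ x)) xE.
split; apply: (@ProjectiveResolution X (fun n => free_module R (syzygy n))
  (fun n => incl n \o free_cover (syzygy n.+1)) (free_cover X)).
- by move=> n; exact: free_module_projective.
- exact: free_cover_surj.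
- exact: inclE 0.
- move=> n y; rewrite -inclE; split=> y0.
    by apply: val_inj; rewrite linear0.
  by rewrite -[LHS]/(incl n (free_cover _ y)) y0 linear0.
Qed.

End Existence.
End Homology.

Section Linkage.
Variable R : comNzRingType.
Implicit Types M X T L P Q K : lmodType R.

Definition superfluous P (W : submodClosed P) : Prop :=
  forall U : submodClosed P,
    (forall x, exists u w, [/\ u \in U, w \in W & x = u + w]) ->
    forall x, x \in U.

Definition projective_cover P X (p : {linear P -> X}) : Prop :=
  [/\ projective P, surjective p & superfluous (kernel p)].

(* P1 -f-> P0 -p-> M -> 0 with both P0 -> M and P1 -> Ker p projective covers *)
Definition minimal_presentation P1 P0 M
    (f : {linear P1 -> P0}) (p : {linear P0 -> M}) : Prop :=
  projective_cover p /\
  exists K (i : {linear K -> P0}) (g : {linear P1 -> K}),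
    [/\ is_kernel i p, projective_cover g & f =1 i \o g].

(* Tr and lambda are defined up to isomorphism only, so they are
   relations: T is a transpose of M, L is a lambda M. *)
Definition is_transpose M T : Prop :=
  exists P1 P0 (f : {linear P1 -> P0}) (p : {linear P0 -> M})
         (q : {linear hom P1 R^o -> T}),
    minimal_presentation f p /\ is_cokernel (hom_pre R^o f) q.

Definition is_lambda M L : Prop :=
  exists T Q (q : {linear Q -> T}) (i : {linear L -> Q}),
    [/\ is_transpose M T, projective_cover q & is_kernel i q].

Definition horizontally_linked M : Prop :=
  exists L N, [/\ is_lambda M L, is_lambda L N & isomorphic M N].

Variable C : lmodType R.

Definition semidualizing : Prop :=
  [/\ finite_module C, bijective (@homothety R C)
    & forall i, (0 < i)%N -> Ext_zero i C C].

Definition totally_reflexive X : Prop :=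
  [/\ finite_module X, bijective (@biduality R C X)
    & forall i, (0 < i)%N -> Ext_zero i X C /\ Ext_zero i (hom X C) C].

(* G_C-dim(X) = 0 *)
Definition GCdim_zero X : Prop := totally_reflexive X.

Definition auslander_class N : Prop :=
  bijective (@tensor_unit R C N) /\
  forall i, (0 < i)%N -> Tor_zero i C N /\ Ext_zero i C (tensor N C).

End Linkage.

(* Main.v *)
(* Write P1 -f-> P0 -> M for the minimal presentation, and write X^C for
   Hom(X, C). Minimality of f makes P1* -> Tr M a projective cover, so L is the
   image of f* in P1*. The map L (x) C -> P1^C is injective: by surjectivity of
   L -> Hom(C, L (x) C) its kernel K satisfies Hom(C, K) = 0, and McCoy's theorem
   then gives K = 0 because C is finite and faithful. Hence there is an exact
   sequence 0 -> M^C -> P0^C -> L (x) C -> 0, whose long exact sequence gives the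
   vanishing of Ext(L (x) C, C); moreover (L (x) C)^C is the first syzygy of M,
   which yields the remaining part of total reflexivity. In particular every map
   L -> R is evaluation at an element of P1. Such maps take values in the Jacobson
   radical, so L is stable. A point of P0 killed by all maps M -> R induces a map
   P0*/M* = L -> R, hence lies in the image of P1; so M is torsionless, and it is
   therefore the kernel of the cover of Tr L. *)
From HB Require Import structures.
From mathcomp Require Import all_boot all_order all_algebra.
From mathcomp Require Import boolp.
From mathcomp Require classical_sets.
Require Import Defs.

Set Implicit Arguments.
Unset Strict Implicit.
Unset Printing Implicit Defensive.

Import GRing.Theory.
Local Open Scope ring_scope.

(** * Factorisations, short exact sequences, pullbacks and retracts *)

Section LinearMaps.
Variable R : comNzRingType.
Implicit Types A B E F K P U V W X Y : lmodType R.

Definition linear_of U V (f : U -> V) (lf : linear f) : {linear U -> V} :=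
  HB.pack f (GRing.isLinear.Build R U V *:%R f lf).

(** The chosen section [s] is not linear, but [h \o s] is: two preimages of the same point differ by
    an element of Ker [q], which [h] kills. *)
Lemma factor_surj B X Y (q : {linear B -> X}) (h : {linear B -> Y}) :
  surjective q -> (forall b, q b = 0 -> h b = 0) ->
  exists h' : {linear X -> Y}, forall b, h' (q b) = h b.
Proof.
move=> q_surj h0; pose s x := sval (cid (q_surj x)).
have sK x : q (s x) = x by exact: svalP (cid (q_surj x)).
have hE b : h (s (q b)) = h b.
  by apply/eqP; rewrite -subr_eq0 -linearB h0 // linearB sK subrr.
have sl : linear (h \o s).
  move=> a x y /=; rewrite -linearP -[RHS]hE; congr (h (s _)).
  by rewrite linearP !sK.
by exists (linear_of sl).
Qed.

Lemma factor_inj A B Y (i : {linear A -> B}) (h : {linear Y -> B}) :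
  injective i -> (forall y, exists a, i a = h y) ->
  exists h' : {linear Y -> A}, forall y, i (h' y) = h y.
Proof.
move=> i_inj hi; pose s y := sval (cid (hi y)).
have sE y : i (s y) = h y by exact: svalP (cid (hi y)).
have sl : linear s by move=> a x y; apply: i_inj; rewrite linearP !sE linearP.
by exists (linear_of sl).
Qed.

Lemma linear_inj U V (f : {linear U -> V}) :
  (forall x, f x = 0 -> x = 0) -> injective f.
Proof.
move=> f0 x y fxy; apply/eqP; rewrite -subr_eq0; apply/eqP/f0.
by rewrite linearB fxy subrr.
Qed.

Lemma inj_surj_bij U V (f : {linear U -> V}) :
  injective f -> surjective f -> bijective f.
Proof.
move=> f_inj f_surj; exists (fun y => sval (cid (f_surj y))) => [x|y].
  by apply: f_inj; exact: svalP (cid (f_surj (f x))).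
exact: svalP (cid (f_surj y)).
Qed.

Lemma bij_surj U V (f : {linear U -> V}) : bijective f -> surjective f.
Proof. by case=> g fK gK y; exists (g y). Qed.

Lemma linear_inverse U V (f : {linear U -> V}) : bijective f ->
  exists g : {linear V -> U}, cancel f g /\ cancel g f.
Proof.
case=> g fK gK; have gl : linear g.
  by move=> a x y; apply: (can_inj fK); rewrite gK linearP !gK.
by exists (linear_of gl).
Qed.

Definition short_exact K F X (i : {linear K -> F}) (q : {linear F -> X}) : Prop :=
  is_kernel i q /\ surjective q.

Definition kernel_incl U V (f : {linear U -> V}) :
  {linear submodule (kernel f) -> U} := val.

Lemma kernel_inclP U V (f : {linear U -> V}) : is_kernel (kernel_incl f) f.
Proof.
split; first exact: val_inj.
move=> y; split=> [y0|[x <-]]; last by apply/kernelP; exact: valP.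
have yk : y \in kernel f by apply/kernelP.
by exists (Sub y yk : submodule (kernel f)).
Qed.

Lemma kernel_exists U V (f : {linear U -> V}) :
  exists K (i : {linear K -> U}), is_kernel i f.
Proof. by exists (submodule (kernel f)), (kernel_incl f); exact: kernel_inclP. Qed.

Lemma short_exact_kernel U V (f : {linear U -> V}) :
  surjective f -> short_exact (kernel_incl f) f.
Proof. by split=> //; exact: kernel_inclP. Qed.

Lemma surj_comp U V W (f : {linear U -> V}) (g : {linear V -> W}) :
  surjective f -> surjective g -> surjective (g \o f).
Proof. by move=> fs gs z; have [y <-] := gs z; have [x <-] := fs y; exists x. Qed.

(** The fibre product, realised as the kernel of the difference map on [F * B]. Its description is
    symmetric in the two legs, so it can be applied with their roles exchanged. *)
Lemma pullback F B X (q : {linear F -> X}) (r : {linear B -> X}) :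
  exists E (u : {linear E -> F}) (v : {linear E -> B}),
    [/\ forall e, q (u e) = r (v e),
        forall y b, q y = r b -> exists e, u e = y /\ v e = b
      & forall e, u e = 0 -> v e = 0 -> e = 0].
Proof.
pose d : {linear (F * B)%type -> X} := (q \o fst) \- (r \o snd).
exists (submodule (kernel d)), (fst \o kernel_incl d), (snd \o kernel_incl d).
split=> [e|y b qr|e /= e1 e2].
- by apply/eqP; rewrite -subr_eq0; exact: (valP e).
- have yb : (y, b) \in kernel d by apply/kernelP; rewrite /= qr subrr.
  by exists (Sub (y, b) yb : submodule (kernel d)).
- apply: val_inj; rewrite [val e]surjective_pairing.
  by move: e1 e2; rewrite /kernel_incl /= => -> ->.
Qed.

Lemma pullback_kernel K F B X E (q : {linear F -> X}) (r : {linear B -> X})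
    (u : {linear E -> F}) (v : {linear E -> B}) (i : {linear K -> F}) :
  (forall e, q (u e) = r (v e)) ->
  (forall y b, q y = r b -> exists e, u e = y /\ v e = b) ->
  (forall e, u e = 0 -> v e = 0 -> e = 0) ->
  short_exact i q ->
  exists k : {linear K -> E}, short_exact k v /\ forall x, u (k x) = i x.
Proof.
move=> uv ex uv0 [[i_inj iq] q_surj].
have u_inj e e' : u e = u e' -> v e = v e' -> e = e'.
  move=> ue ve; apply/eqP; rewrite -subr_eq0; apply/eqP/uv0;
  by rewrite linearB ?ue ?ve subrr.
have ki x : exists e, u e = i x /\ v e = 0.
  by apply: ex; rewrite linear0 iq; exists x.
pose k x := sval (cid (ki x)).
have kE x : u (k x) = i x /\ v (k x) = 0 by exact: svalP (cid (ki x)).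
have kl : linear k.
  move=> a x y; apply: u_inj; rewrite linearP.
    by rewrite !(proj1 (kE _)) linearP.
  by rewrite !(proj2 (kE _)) scaler0 addr0.
exists (linear_of kl); split; last by move=> x; case: (kE x).
split; last by move=> b; have [y /ex[e [_]]] := q_surj (r b); exists e.
split=> [x y kxy|e].
  by apply: i_inj; rewrite -(proj1 (kE x)) -(proj1 (kE y)); congr (u _).
split=> [ve|[x <-]]; last exact: (proj2 (kE x)).
have /iq[x ix] : q (u e) = 0 by rewrite uv ve linear0.
by exists x; apply: u_inj => /=; rewrite ?ve ?(proj1 (kE _)) ?(proj2 (kE _)).
Qed.

(** As in Schanuel's lemma, the fibre product [E] is at once an extension of [F'] by [K] and of [F]
    by [K']. *)
Lemma pullback_short_exact K F K' F' X (i : {linear K -> F}) (q : {linear F -> X})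
    (i' : {linear K' -> F'}) (q' : {linear F' -> X}) :
  short_exact i q -> short_exact i' q' ->
  exists E (u : {linear E -> F}) (v : {linear E -> F'})
    (k : {linear K -> E}) (k' : {linear K' -> E}),
    [/\ short_exact k v, forall x, u (k x) = i x,
        short_exact k' u & forall x, v (k' x) = i' x].
Proof.
move=> iq iq'; have [E [u [v [uv ex uv0]]]] := pullback q q'.
have [k [kv uk]] := pullback_kernel uv ex uv0 iq.
have [|y b /esym/ex[e []]||k' [k'u vk']] := @pullback_kernel _ _ _ _ _ q' q v u i' _ _ _ iq'.
- by move=> e; rewrite uv.
- by exists e.
- by move=> e ve ue; exact: uv0.
by exists E, u, v, k, k'.
Qed.

Definition retract U V : Prop :=
  exists (s : {linear U -> V}) (r : {linear V -> U}), cancel s r.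

Lemma retract_projective U V : retract U V -> projective V -> projective U.
Proof.
move=> [s [r sK]] Vp A B g f gs; have [h hE] := Vp _ _ g (f \o r) gs.
by exists (h \o s) => x /=; rewrite -[LHS]/((g \o h) (s x)) hE /= sK.
Qed.

Lemma projective_section P X (q : {linear X -> P}) : projective P ->
  surjective q -> exists s : {linear P -> X}, cancel s q.
Proof. by move=> Pp qs; have [s sE] := Pp _ _ q idfun qs; exists s => x; exact: sE. Qed.

Lemma projective_pair P P' : projective P -> projective P' ->
  projective (P * P')%type.
Proof.
move=> Pp Pp' U V g f gs.
have f1l : linear (fun x : P => f (x, 0)).
  by move=> a x y; rewrite -linearP; congr (f (_, _)); rewrite /= scaler0 addr0.
have f2l : linear (fun x : P' => f (0, x)).
  by move=> a x y; rewrite -linearP; congr (f (_, _)); rewrite /= scaler0 addr0.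
have [h hE] := Pp _ _ g (linear_of f1l) gs.
have [h' hE'] := Pp' _ _ g (linear_of f2l) gs.
exists ((h \o fst) \+ (h' \o snd)) => -[x y] /=.
rewrite linearD -[g (h x)]/((g \o h) x) hE -[g (h' y)]/((g \o h') y) hE' /=.
by rewrite -linearD; congr (f (_, _)); rewrite /= ?addr0 ?add0r.
Qed.

Lemma projective_cover_exists X :
  exists F (q : {linear F -> X}), projective F /\ surjective q.
Proof.
exists (free_module R X), (free_cover X).
by split; [exact: free_module_projective|exact: free_cover_surj].
Qed.

Lemma retract_kernel E A F (k : {linear A -> E}) (u : {linear E -> F}) :
  projective F -> short_exact k u -> retract A E.
Proof.
move=> Fp [[k_inj ku] u_surj]; have [s sK] := projective_section Fp u_surj.
have [e|r rE] := @factor_inj _ _ _ k (idfun \- (s \o u)) k_inj.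
  by apply/ku; rewrite /= linearB sK subrr.
exists k, r => x; apply: k_inj; rewrite rE /=.
by have -> : u (k x) = 0; [apply/ku; exists x|rewrite linear0 subr0].
Qed.
End LinearMaps.
Arguments kernel_incl {R U V} f : simpl never.

(** * Ext vanishing *)

Section Ext.
Variable R : comNzRingType.
Implicit Types A B E F K P U V W X Y : lmodType R.

(** [Q] is [P] with [F] put in front, the joint being [i \o res_aug P]. This is the dimension shift
    Ext^{n+2}(X) = Ext^{n+1}(K) at the level of complexes. *)
Lemma splice K F X (i : {linear K -> F}) (q : {linear F -> X})
    (P : projective_resolution K) : projective F -> short_exact i q ->
  exists Q : projective_resolution X, forall Y,
    (exact (hom_pre Y (i \o res_aug P)) (hom_pre Y (res_diff P 0)) <->
       exact (hom_pre Y (res_diff Q 0)) (hom_pre Y (res_diff Q 1))) /\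
    forall n, (exact (hom_pre Y (res_diff P n)) (hom_pre Y (res_diff P n.+1)) <->
       exact (hom_pre Y (res_diff Q n.+1)) (hom_pre Y (res_diff Q n.+2))).
Proof.
move=> Fp [[i_inj iq] q_surj].
pose t n := if n is m.+1 then res_term P m else F.
pose d n : {linear t n.+1 -> t n} :=
  match n with 0 => i \o res_aug P | m.+1 => res_diff P m end.
have tp n : projective (t n) by case: n => [//|n]; exact: res_projective.
have e0 : exact (d 0) q.
  move=> y; rewrite iq; split=> [[x <-]|[x <-]]; last by exists (res_aug P x).
  by have [z <-] := res_aug_surj P x; exists z.
have eS n : exact (d n.+1) (d n).
  case: n => [|n] y; last exact: (@res_exact _ _ P).
  rewrite -(@res_exact0 _ _ P) /=; split=> [iy|->]; last by rewrite linear0.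
  by apply: i_inj; rewrite iy linear0.
by exists (ProjectiveResolution tp q_surj e0 eS) => Y; split.
Qed.

(** Inverse to splicing: deleting the term of degree 0 leaves a resolution of the first syzygy. *)
Lemma truncate X (Q : projective_resolution X) K (i : {linear K -> Q 0}) :
  is_kernel i (res_aug Q) ->
  exists P : projective_resolution K, forall Y n,
    exact (hom_pre Y (res_diff P n)) (hom_pre Y (res_diff P n.+1)) <->
    exact (hom_pre Y (res_diff Q n.+1)) (hom_pre Y (res_diff Q n.+2)).
Proof.
move=> [i_inj iq].
have [y|a aE] := @factor_inj _ _ _ _ i (res_diff Q 0) i_inj.
  by apply/iq/(@res_exact0 _ _ Q); exists y.
have tp n : projective (Q n.+1) by exact: res_projective.
have as_ : surjective a.
  move=> x; have /(@res_exact0 _ _ Q)[y yE] : res_aug Q (i x) = 0 by apply/iq; exists x.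
  by exists y; apply: i_inj; rewrite aE.
have e0 : exact (res_diff Q 1) a.
  move=> y; rewrite -(@res_exact _ _ Q _) -aE; split=> [->|ay]; first exact: linear0.
  by apply: i_inj; rewrite ay linear0.
by exists (ProjectiveResolution tp as_ e0 (fun n => @res_exact _ _ Q n.+1)) => Y n.
Qed.

Variable C : lmodType R.

(* [ext_vanish n X] says that Ext^{n+1}(X, C) = 0, by dimension shifting. *)
Fixpoint ext_vanish n X : Prop :=
  forall K F (i : {linear K -> F}) (q : {linear F -> X}),
    projective F -> short_exact i q ->
    if n is m.+1 then ext_vanish m K
    else forall h : {linear K -> C}, exists h' : {linear F -> C}, h' \o i =1 h.

(** [Ext_zero] speaks of every resolution, so it may be tested on one that begins with the given
    [F]. *)
Lemma ext_zero_vanish n X : Ext_zero n.+1 X C -> ext_vanish n X.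
Proof.
elim: n X => [|n IHn] X XE K F i q Fp iq.
  move=> h; have [P] := projective_resolution_exists K.
  have [Q /(_ C)[QE _]] := splice P Fp iq.
  have /(_ (h \o res_aug P))[+ _] := QE.2 (XE Q).
  case=> [|h' h'E].
    apply: hom_ext => x /=; have -> : res_aug P (res_diff P 0 x) = 0.
      by apply/(@res_exact0 _ _ P); exists x.
    by rewrite linear0.
  exists h' => x; have [y <-] := res_aug_surj P x.
  exact: (congr1 (fun g : hom _ _ => g y) h'E).
apply: IHn => P; have [Q /(_ C)[_ QE]] := splice P Fp iq.
exact/QE/XE.
Qed.

Lemma ext_vanish_zero n X : ext_vanish n X -> Ext_zero n.+1 X C.
Proof.
elim: n X => [|n IHn] X XE Q.
  have XQ := XE _ _ _ _ (@res_projective _ _ Q 0) (short_exact_kernel (@res_aug_surj _ _ Q)).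
  have ki := kernel_inclP (res_aug Q).
  move: (kernel_incl _) XQ ki => i XQ ki.
  have [y|a aE] := @factor_inj _ _ _ _ i (res_diff Q 0) ki.1.
    by apply/ki.2/(@res_exact0 _ _ Q); exists y.
  move=> u; split=> [u0|[v <-]]; last first.
    apply: hom_ext => x /=; have -> : res_diff Q 0 (res_diff Q 1 x) = 0.
      by apply/(@res_exact _ _ Q _); exists x.
    by rewrite linear0.
  have a_surj : surjective a.
    move=> x; have /(@res_exact0 _ _ Q)[y yE] : res_aug Q (i x) = 0.
      by apply/ki.2; exists x.
    by exists y; apply: ki.1; rewrite aE.
  have [y ay|h hE] := @factor_surj _ _ _ _ a (u : {linear _ -> _}) a_surj.
    have /(@res_exact _ _ Q _)[z <-] : res_diff Q 0 y = 0 by rewrite -aE ay linear0.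
    by rewrite -[LHS]/((hom_pre C (res_diff Q 1) u) z) u0.
  have [h' h'E] := XQ h.
  exists h'; apply: hom_ext => x /=.
  rewrite -aE -hE; exact: h'E.
have [P /(_ C) PE] := truncate (kernel_inclP (res_aug Q)).
apply/PE; apply: IHn.
exact: XE (@res_projective _ _ Q 0) (short_exact_kernel (@res_aug_surj _ _ Q)).
Qed.

(** A sequence ending in a projective module splits, so maps on [K] extend to [F]; moreover [K] is
    then projective, which feeds the induction. *)
Lemma ext_vanish_projective n P : projective P -> ext_vanish n P.
Proof.
elim: n P => [|n IHn] P Pp K F i q Fp iq.
  have [s [r rE]] := retract_kernel Pp iq.
  have [[i_inj iqx] q_surj] := iq.
  have [t tK] := projective_section Pp q_surj.
  have [x|w wE] := @factor_inj _ _ _ _ i (idfun \- (t \o q)) i_inj.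
    by apply/iqx; rewrite /= linearB tK subrr.
  move=> h; exists (h \o w) => x /=; congr (h _); apply: i_inj; rewrite wE /=.
  by have -> : q (i x) = 0; [apply/iqx; exists x|rewrite linear0 subr0].
exact: IHn (retract_projective (retract_kernel Pp iq) Fp).
Qed.

(* [F] need not be projective in the case n = 0. *)
Lemma ext_vanish_extend X K F (i : {linear K -> F}) (q : {linear F -> X})
    (h : {linear K -> C}) :
  ext_vanish 0 X -> short_exact i q -> exists h' : {linear F -> C}, h' \o i =1 h.
Proof.
move=> XE [[i_inj iq] q_surj].
have [G [g [Gp g_surj]]] := projective_cover_exists F.
have gq_surj := surj_comp g_surj q_surj.
have ki := kernel_inclP (q \o g); move: (kernel_incl _) ki => j ki.
have [y|a aE] := @factor_inj _ _ _ _ i (g \o j) i_inj.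
  by apply/iq; rewrite -[LHS]/((q \o g) (j y)); apply/ki.2; exists y.
have [t tE] := XE _ _ _ _ Gp (conj ki gq_surj) (h \o a).
(* [t] descends along [g]: a point of Ker [g] comes from some [z] with [a z = 0], and [t] is
   [h \o a] there. *)
have [y gy|h' h'E] := @factor_surj _ _ _ _ g t g_surj.
  have /ki.2[z zy] : (q \o g) y = 0 by rewrite /= gy linear0.
  have az : a z = 0 by apply: i_inj; rewrite aE /= zy gy linear0.
  by rewrite -zy -[LHS]/((t \o j) z) tE /= az linear0.
exists h' => x /=; have [y yE] := g_surj (i x).
have /ki.2[z zy] : (q \o g) y = 0 by rewrite /= yE; apply/iq; exists x.
rewrite -yE h'E -zy -[LHS]/((t \o j) z) tE /=; congr (h _).
by apply: i_inj; rewrite aE /= zy.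
Qed.

Lemma short_exact_pair K F X K' F' X' (i : {linear K -> F}) (q : {linear F -> X})
    (i' : {linear K' -> F'}) (q' : {linear F' -> X'}) :
  short_exact i q -> short_exact i' q' ->
  exists (j : {linear (K * K')%type -> (F * F')%type})
         (r : {linear (F * F')%type -> (X * X')%type}),
    [/\ short_exact j r, forall x, j x = (i x.1, i' x.2)
      & forall x, r x = (q x.1, q' x.2)].
Proof.
move=> [[i_inj iq] qs] [[i'_inj iq'] qs'].
have jl : linear (fun x : K * K' => (i x.1, i' x.2)).
  by move=> a x y; congr (_, _); rewrite /= linearP.
have rl : linear (fun x : F * F' => (q x.1, q' x.2)).
  by move=> a x y; congr (_, _); rewrite /= linearP.
exists (linear_of jl), (linear_of rl); split=> //; split.
  split=> [[x x'] [y y'] [/i_inj-> /i'_inj->] //|[x x']].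
  split=> [[/iq[y <-] /iq'[y' <-]]|[[y y'] [<- <-]]]; first by exists (y, y').
  by congr (_, _); [apply/iq; exists y|apply/iq'; exists y'].
by move=> [x x']; have [y <-] := qs x; have [y' <-] := qs' x'; exists (y, y').
Qed.

Lemma retract_pair K K' : retract K (K * K')%type.
Proof.
have sl : linear (fun x : K => (x, 0 : K')).
  by move=> a x y; congr (_, _); rewrite /= scaler0 addr0.
by exists (linear_of sl), fst.
Qed.

Lemma short_exact_comp_bij K F X Y (i : {linear K -> F}) (q : {linear F -> X})
    (f : {linear X -> Y}) : bijective f -> short_exact i q -> short_exact i (f \o q).
Proof.
move=> fb [[i_inj iq] qs]; split; last exact: surj_comp (bij_surj fb).
split=> // y; rewrite -iq /=; split=> [fy|->]; last exact: linear0.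
by apply: (bij_inj fb); rewrite fy linear0.
Qed.

(** With [N] the kernel of the retraction, [E] is isomorphic to [A * N]. Adding a projective
    presentation of [N] to the given one of [A] presents [E], and its kernel [K * K'] has [K] as a
    retract. *)
Lemma ext_vanish_retract n A E : retract A E -> ext_vanish n E -> ext_vanish n A.
Proof.
elim: n A E => [|n IHn] A E [s [r sK]] EE K F i q Fp iq.
all: have [N [k kr]] := kernel_exists r.
all: have [F' [q' [Fp' qs']]] := projective_cover_exists N.
all: have [K' [i' ki']] := kernel_exists q'; have iq' : short_exact i' q' by [].
all: have [j [p [jp jE pE]]] := short_exact_pair iq iq'.
all: pose f : {linear (A * N)%type -> E} :=
  (s \o fst) \+ (k \o snd).
all: have rk x : r (k x) = 0 by apply/kr.2; exists x.
all: have fb : bijective f.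
1,3: apply: inj_surj_bij => [|e].
1,3: apply: linear_inj => -[x y] /= xy0.
1,2: have x0 : x = 0 by have := congr1 r xy0; rewrite linearD rk sK linear0 addr0.
1,2: congr (_, _) => //; apply: kr.1; rewrite linear0.
1,2: by move: xy0; rewrite x0 linear0 add0r.
1,2: have /kr.2[y yE] : r (e - s (r e)) = 0 by rewrite linearB sK subrr.
1,2: by exists (r e, y); rewrite /= yE addrC subrK.
all: have := EE _ _ _ _ (projective_pair Fp Fp') (short_exact_comp_bij fb jp).
- move=> EE' h; have [h' h'E] := EE' (h \o fst).
  have tl : linear (fun x : F => h' (x, 0)).
    by move=> a x y; rewrite -linearP; congr (h' (_, _)); rewrite /= scaler0 addr0.
  by exists (linear_of tl) => x; have := h'E (x, 0); rewrite /= jE /= linear0.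
- exact/IHn/retract_pair.
Qed.

(** Stated for a single [n] so that two inductions can interleave: this property at [n] gives the
    vanishing for kernels at [n], which in turn gives this property at [n.+1]. *)
Definition ext_vanish_middle_prop n := forall A E B
  (k : {linear A -> E}) (v : {linear E -> B}), short_exact k v ->
  ext_vanish n A -> ext_vanish n B -> ext_vanish n E.

(** Pull [q] back along a projective [F] mapping onto [X]. The pullback is an extension of [B] by
    the syzygy of [X], so its Ext vanishes; it also maps onto [F] with kernel [A], so [A] is a
    retract of it. *)
Lemma ext_vanish_kernel_of_middle n : ext_vanish_middle_prop n ->
  forall A B X (i : {linear A -> B}) (q : {linear B -> X}), short_exact i q ->
  ext_vanish n B -> ext_vanish n.+1 X -> ext_vanish n A.
Proof.
move=> mid A B X i q iq BE XE.
have [F [g [Fp gs]]] := projective_cover_exists X.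
have kg := short_exact_kernel gs; have KE := XE _ _ _ _ Fp kg.
have [E [u [v [k [k' [kv _ k'u _]]]]]] := pullback_short_exact kg iq.
exact: ext_vanish_retract (retract_kernel Fp k'u) (mid _ _ _ _ _ kv KE BE).
Qed.

Lemma ext_vanish_middle n : ext_vanish_middle_prop n.
Proof.
elim: n => [|n IHn] A E B k v kv AE BE K F i q Fp iq.
(* [D] is the preimage of [A] in [F]. It is an extension of [A] by [K], and also a first syzygy of
   [B]. *)
all: have [D [u [w [uw ex uw0]]]] := pullback q k.
all: have [j [jw uj]] := pullback_kernel uw ex uw0 iq.
all: have uq : short_exact u (v \o q).
1,3: split; [split|exact: surj_comp iq.2 kv.2].
1,3: apply: linear_inj => e ue; apply: uw0 => //; apply: kv.1.1;
     by rewrite -uw ue !linear0.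
1,2: move=> y; split=> [/kv.1.2[a /esym/ex[e [<- _]]]|[e <-]]; first by exists e.
1,2: by rewrite /= uw; apply/kv.1.2; exists (w e).
(* Extend [h] from [K] to [D] using [A], then from [D] to [F] using [B]. *)
- move=> h; have [h1 h1E] := ext_vanish_extend h AE jw.
  have [h2 h2E] := BE _ _ _ _ Fp uq h1.
  by exists h2 => x /=; rewrite -uj -[LHS]/((h2 \o u) (j x)) h2E -[LHS]/((h1 \o j) x) h1E.
exact: ext_vanish_kernel_of_middle IHn _ _ _ _ _ jw (BE _ _ _ _ Fp uq) AE.
Qed.

Lemma ext_vanish_kernel n A B X (i : {linear A -> B}) (q : {linear B -> X}) :
  short_exact i q -> ext_vanish n B -> ext_vanish n.+1 X -> ext_vanish n A.
Proof. exact/ext_vanish_kernel_of_middle/ext_vanish_middle. Qed.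

(** The extension hypothesis makes Hom(B, C) -> Hom(A, C) surjective, so the connecting map into
    Ext^1(X, C) is zero; the higher degrees come from the long exact sequence. *)
Lemma ext_vanish_cokernel n A B X (i : {linear A -> B}) (q : {linear B -> X}) :
  short_exact i q ->
  (forall h : {linear A -> C}, exists h' : {linear B -> C}, h' \o i =1 h) ->
  (forall m, ext_vanish m A) -> (forall m, ext_vanish m B) -> ext_vanish n X.
Proof.
move=> iq ihom AE BE; case: n => [|n] K F j p Fp jp.
all: have [E [u [v [k [k' [kv uk k'u vk']]]]]] := pullback_short_exact jp iq.
all: have FE m := ext_vanish_projective m Fp.
  2: exact: ext_vanish_kernel kv (ext_vanish_middle k'u (AE n) (FE n)) (BE n.+1).
move=> h; have [h1 h1E] := ext_vanish_extend h (BE 0) kv.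
have [t tE] := ihom (h1 \o k').
(* [t] is chosen so that [h1 \- (t \o v)] vanishes on [A] and descends to [F]. The correction does
   not disturb [h], since [v] is zero on [K]. *)
have [|h' h'E] := @factor_surj _ _ _ _ u (h1 \- (t \o v)) k'u.2.
  move=> e /k'u.1.2[a <-] /=; rewrite vk' -[t (i a)]/((t \o i) a) tE /=.
  by rewrite subrr.
exists h' => x /=; rewrite -uk h'E /=.
have -> : v (k x) = 0 by apply/kv.1.2; exists x.
by rewrite linear0 subr0 -[LHS]/((h1 \o k) x) h1E.
Qed.
End Ext.

(** * Finite projective modules *)

Section FiniteModules.
Variable R : comNzRingType.
Implicit Types P U V W X Y C : lmodType R.

Lemma finite_surj V W (f : {linear V -> W}) :
  surjective f -> finite_module V -> finite_module W.
Proof.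
move=> fs [n [g gV]]; exists n, (f \o g) => y; have [x <-] := fs y.
have [c ->] := gV x; exists c; rewrite linear_sum; apply: eq_bigr => i _.
by rewrite linearZ.
Qed.

Lemma finite_indexed (I : finType) V (g : I -> V) :
  (forall x, exists c : I -> R, x = \sum_i c i *: g i) -> finite_module V.
Proof.
move=> gV; exists #|I|, (g \o enum_val) => x; have [c ->] := gV x.
exists (c \o enum_val); rewrite (reindex (@enum_val I I)) //=.
by apply: onW_bij; exact: enum_val_bij.
Qed.

Section RowCombination.
Variables (V : lmodType R) (n : nat) (g : 'I_n -> V).
Definition row_combination_fun (v : 'rV[R]_n) : V := \sum_i v 0 i *: g i.
Lemma row_combination_fun_linear : linear row_combination_fun.
Proof.
move=> a u v; rewrite /row_combination_fun scaler_sumr -big_split /=.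
by apply: eq_bigr => i _; rewrite !mxE scalerDl scalerA.
Qed.
Definition row_combination : {linear 'rV[R]_n -> V} :=
  linear_of row_combination_fun_linear.
Lemma row_combinationE v : row_combination v = \sum_i v 0 i *: g i.
Proof. by []. Qed.
Lemma row_combination_delta i : row_combination (delta_mx 0 i) = g i.
Proof.
rewrite row_combinationE (bigD1 i) //= !mxE !eqxx scale1r big1 ?addr0 // => j ji.
by rewrite mxE (negPf ji) andbF scale0r.
Qed.
End RowCombination.

Lemma row_ext V n (f h : {linear 'rV[R]_n -> V}) :
  (forall i, f (delta_mx 0 i) = h (delta_mx 0 i)) -> f =1 h.
Proof.
move=> fh v; rewrite (row_sum_delta v) !linear_sum; apply: eq_bigr => i _.
by rewrite !linearZ /= fh.
Qed.

Lemma projective_row n : projective 'rV[R]_n.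
Proof.
move=> U V g f gs; pose s i := sval (cid (gs (f (delta_mx 0 i)))).
exists (row_combination s).
apply: (@row_ext _ _ (g \o row_combination s)) => i.
rewrite -[LHS]/(g (row_combination s (delta_mx 0 i))) row_combination_delta.
exact: svalP (cid (gs (f (delta_mx 0 i)))).
Qed.

Lemma finite_row n : finite_module 'rV[R]_n.
Proof.
by exists n, (fun i => delta_mx 0 i) => v; exists (v 0); exact: row_sum_delta.
Qed.

Lemma row_combination_surj V n (g : 'I_n -> V) :
  (forall x, exists c : 'I_n -> R, x = \sum_i c i *: g i) ->
  surjective (row_combination g).
Proof.
move=> gV x; have [c ->] := gV x; exists (\row_i c i).
by rewrite row_combinationE; apply: eq_bigr => i _; rewrite mxE.
Qed.

Definition dual_basis P n (x : 'I_n -> P) (a : 'I_n -> hom P R^o) : Prop :=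
  forall y, y = \sum_i (a i y : R) *: x i.

Lemma dual_basis_exists P : projective P -> finite_module P ->
  exists n (x : 'I_n -> P) (a : 'I_n -> hom P R^o), dual_basis x a.
Proof.
move=> Pp [n [x xP]].
have [s sK] := projective_section Pp (row_combination_surj xP).
have al i : linear (fun y : P => s y 0 i : R^o).
  by move=> c y z; rewrite linearP !mxE.
by exists n, x, (fun i => linear_of (al i)) => y; rewrite -[LHS]sK.
Qed.

Lemma dual_basis_hom P n (x : 'I_n -> P) (a : 'I_n -> hom P R^o) Y
    (f : {linear P -> Y}) : dual_basis x a ->
  forall y, f y = \sum_i (a i y : R) *: f (x i).
Proof.
move=> xa y; rewrite {1}(xa y) linear_sum; apply: eq_bigr => i _.
by rewrite linearZ.
Qed.

Lemma hom_sumE U V (I : Type) (r : seq I) (F : I -> hom U V) x :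
  (\sum_(i <- r) F i : hom U V) x = \sum_(i <- r) F i x.
Proof. by elim/big_rec2: _ => // i y f _ <-. Qed.

Lemma dual_basis_dual P n (x : 'I_n -> P) (a : 'I_n -> hom P R^o)
    (f : hom P R^o) : dual_basis x a -> f = \sum_i (f (x i) : R) *: a i.
Proof.
move=> xa; apply: hom_ext => y; rewrite hom_sumE (dual_basis_hom _ xa).
by apply: eq_bigr => i _; exact: mulrC.
Qed.

Lemma finite_dual P : projective P -> finite_module P -> finite_module (hom P R^o).
Proof.
move=> Pp Pf; have [n [x [a xa]]] := dual_basis_exists Pp Pf.
by exists n, a => f; exists (fun i => f (x i)); exact: dual_basis_dual.
Qed.

(** Evaluation at the [x i] is split by the map sending [c] to the sum of the [a i] times [c i]. Ext
    vanishing thus passes from powers of [C] to [hom P C]. *)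
Lemma hom_retract_power P n (x : 'I_n -> P) (a : 'I_n -> hom P R^o) C :
  dual_basis x a -> retract (hom P C) {ffun 'I_n -> C}.
Proof.
move=> xa; have sl : linear (fun f : hom P C => [ffun i => f (x i)]).
  by move=> c f g; apply/ffunP => i; rewrite !ffunE.
have rl1 (c : {ffun 'I_n -> C}) : linear (fun y => \sum_i (a i y : R) *: c i).
  move=> k y z; rewrite scaler_sumr -big_split; apply: eq_bigr => i _.
  by rewrite linearP scalerDl scalerA.
have rl : linear (fun c : {ffun 'I_n -> C} => linear_of (rl1 c) : hom P C).
  move=> k c d; apply: hom_ext => y /=; rewrite scaler_sumr -big_split.
  by apply: eq_bigr => i _; rewrite !ffunE scalerDr !scalerA mulrC.
exists (linear_of sl), (linear_of rl) => f; apply: hom_ext => y /=.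
by rewrite (dual_basis_hom _ xa); apply: eq_bigr => i _; rewrite ffunE.
Qed.

Lemma projective_dual P : projective P -> finite_module P -> projective (hom P R^o).
Proof.
move=> Pp Pf; have [n [x [a xa]]] := dual_basis_exists Pp Pf.
have sl : linear (fun f : hom P R^o => \row_i (f (x i) : R)).
  by move=> c f g; apply/rowP => i; rewrite !mxE.
apply: (retract_projective _ (@projective_row n)).
exists (linear_of sl), (row_combination a) => f.
rewrite row_combinationE [RHS](dual_basis_dual f xa).
by apply: eq_bigr => i _; rewrite mxE.
Qed.

Lemma finite_hom P C : projective P -> finite_module P -> finite_module C ->
  finite_module (hom P C).
Proof.
move=> Pp Pf [m [g gC]]; have [n [x [a xa]]] := dual_basis_exists Pp Pf.
have gl i j : linear (fun y => (a i y : R) *: g j).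
  by move=> c y z; rewrite linearP scalerDl scalerA.
apply: (@finite_indexed ('I_n * 'I_m)%type _ (fun ij => linear_of (gl ij.1 ij.2) : hom P C)).
move=> f; have /choice[c cE] : forall i, exists c : 'I_m -> R, f (x i) = \sum_j c j *: g j.
  by move=> i; exact: gC.
exists (fun ij => c ij.1 ij.2); apply: hom_ext => y.
rewrite hom_sumE (dual_basis_hom _ xa).
rewrite (eq_bigr (fun i => \sum_j (a i y : R) *: (c i j *: g j))); last first.
  by move=> i _; rewrite cE scaler_sumr.
rewrite pair_big; apply: eq_bigr => -[i j] _ /=.
by rewrite !scalerA mulrC.
Qed.

Lemma ext_vanish_power C D m n : ext_vanish C m D ->
  ext_vanish C m {ffun 'I_n -> D}.
Proof.
move=> DE; elim: n => [|n IHn].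
  (* The empty power is the zero module, a retract of ['rV[R]_0]. *)
  apply/ext_vanish_projective/(retract_projective _ (@projective_row 0)).
  exists \0, \0 => f; apply/ffunP => i; by case: i.
have il : linear (fun d : D => [ffun i : 'I_n.+1 => if i == ord0 then d else 0]).
  move=> c x y; apply/ffunP => i; rewrite !ffunE.
  by case: ifP => _ //; rewrite scaler0 addr0.
have ql : linear (fun f : {ffun 'I_n.+1 -> D} => [ffun i : 'I_n => f (lift ord0 i)]).
  by move=> c f g; apply/ffunP => i; rewrite !ffunE.
apply: (@ext_vanish_middle _ _ _ _ _ _ (linear_of il) (linear_of ql) _ DE IHn).
split; last first.
  move=> f; exists [ffun i => if unlift ord0 i is Some j then f j else 0].
  by apply/ffunP => i; rewrite !ffunE liftK.
split=> [x y /ffunP/(_ ord0)|f]; first by rewrite !ffunE eqxx.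
split=> [/ffunP f0|[d <-]]; last first.
  by apply/ffunP => i; rewrite !ffunE.
exists (f ord0); apply/ffunP => i; rewrite !ffunE.
case: (unliftP ord0 i) => [j ->|-> //]; rewrite eq_sym (negPf (neq_lift _ _)).
by have := f0 j; rewrite !ffunE.
Qed.

Lemma ext_vanish_hom C P m : projective P -> finite_module P ->
  ext_vanish C m C -> ext_vanish C m (hom P C).
Proof.
move=> Pp Pf CE; have [n [x [a xa]]] := dual_basis_exists Pp Pf.
exact: ext_vanish_retract (hom_retract_power C xa) (ext_vanish_power n CE).
Qed.
End FiniteModules.

(** * Radical, Nakayama and projective covers *)

Lemma rpred_submodB (R : comNzRingType) (V : lmodType R) (W : submodClosed V) x y :
  x \in W -> y \in W -> x - y \in W.
Proof. by move=> xW yW; rewrite -scaleN1r rpredD // rpredZ. Qed.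

Section Submodules.
Variables (R : comNzRingType) (V : lmodType R) (S : V -> Prop).
Hypotheses (S0 : S 0) (SD : forall x y, S x -> S y -> S (x + y))
  (SZ : forall a x, S x -> S (a *: x)).

Definition in_submod_of : V -> bool := fun x => `[< S x >].
Lemma submod_of_closed : subsemimod_closed in_submod_of.
Proof.
split=> [|a x /asboolP xS]; last by apply/asboolP; exact: SZ.
split=> [|x y /asboolP xS /asboolP yS]; apply/asboolP => //; exact: SD.
Qed.
HB.instance Definition _ :=
  GRing.isSubmodClosed.Build R V in_submod_of submod_of_closed.
Definition submod_of : submodClosed V := GRing.SubmodClosed.clone R V in_submod_of _.
Lemma submod_ofP x : reflect (S x) (x \in submod_of).
Proof. exact: asboolP. Qed.
End Submodules.

Section Image.
Variables (R : comNzRingType) (U V : lmodType R) (f : {linear U -> V}).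
Variable W : submodClosed V.

Lemma image_exists : exists I : submodClosed V,
  forall y, y \in I <-> exists x, f x = y.
Proof.
have S0 : exists x, f x = 0 by exists 0; rewrite linear0.
have SD y y' : (exists x, f x = y) -> (exists x, f x = y') -> exists x, f x = y + y'.
  by move=> [x <-] [x' <-]; exists (x + x'); rewrite linearD.
have SZ a y : (exists x, f x = y) -> exists x, f x = a *: y.
  by move=> [x <-]; exists (a *: x); rewrite linearZ.
exists (submod_of S0 SD SZ) => y; exact: iff_sym (rwP (submod_ofP S0 SD SZ y)).
Qed.

Lemma preimage_exists : exists I : submodClosed U, forall x, x \in I <-> f x \in W.
Proof.
have S0 : f 0 \in W by rewrite linear0 rpred0.
have SD x x' : f x \in W -> f x' \in W -> f (x + x') \in W.
  by move=> xW x'W; rewrite linearD rpredD.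
have SZ a x : f x \in W -> f (a *: x) \in W by move=> xW; rewrite linearZ rpredZ.
exists (submod_of S0 SD SZ) => y; exact: iff_sym (rwP (submod_ofP S0 SD SZ y)).
Qed.
End Image.

Section Radical.
Variable R : comNzRingType.
Implicit Types P U V W X Y : lmodType R.

Definition invertible (r : R) : Prop := exists s, r * s = 1.

(** The Jacobson radical, described by units instead of maximal ideals. *)
Definition in_radical (r : R) : Prop := forall a, invertible (1 - a * r).

Lemma in_radicalM a r : in_radical r -> in_radical (a * r).
Proof. by move=> rJ b; rewrite mulrA. Qed.

Lemma in_radical0 : in_radical 0.
Proof. by move=> a; exists 1; rewrite mulr0 subr0 mulr1. Qed.

Lemma in_radicalD r s : in_radical r -> in_radical s -> in_radical (r + s).
Proof.
move=> rJ sJ a; have [t tE] := rJ a; have [u uE] := sJ (t * a).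
exists (t * u).
(* Here [t] inverts [1 - a * r], so the second factor times [1 - a * r] restores the term
   [a * s]. *)
have -> : 1 - a * (r + s) = (1 - a * r) * (1 - t * a * s).
  rewrite mulrBr mulr1 (_ : _ * (t * a * s) = ((1 - a * r) * t) * (a * s)).
    by rewrite tE mul1r mulrDr opprD addrA.
  by rewrite !mulrA.
rewrite mulrACA tE mul1r; exact: uE.
Qed.

Lemma in_radical_sum (I : finType) (F : I -> R) :
  (forall i, in_radical (F i)) -> in_radical (\sum_i F i).
Proof.
move=> FJ; apply: (big_ind in_radical) => //; first exact: in_radical0.
exact: in_radicalD.
Qed.

(** Nakayama's lemma by Gaussian elimination: [1 - c ord0 ord0] has an inverse [s], so the first
    relation expresses [v ord0] through the others modulo [U]. Substituting it keeps all
    coefficients in the radical. *)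
Lemma nakayama V n (v : 'I_n -> V) (U : submodClosed V) (c : 'I_n -> 'I_n -> R) :
  (forall i j, in_radical (c i j)) ->
  (forall i, v i - \sum_j c i j *: v j \in U) -> forall i, v i \in U.
Proof.
elim: n v c => [|n IHn] v c cJ vU; first by case.
have [s sE] : invertible (1 - 1 * c ord0 ord0) by exact: cJ.
rewrite mul1r mulrC in sE.
have wU : v ord0 - \sum_j (s * c ord0 (lift ord0 j)) *: v (lift ord0 j) \in U.
  have := rpredZ s (vU ord0); rewrite big_ord_recl opprD addrA scalerBr.
  rewrite -{1}[v ord0]scale1r -scalerBl scalerA sE scale1r scaler_sumr.
  by under eq_bigr do rewrite scalerA.
have vU' i : v (lift ord0 i) \in U.
  move: i; apply: (IHn _ (fun i j => c (lift ord0 i) (lift ord0 j) +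
      c (lift ord0 i) ord0 * s * c ord0 (lift ord0 j))) => [i j|i].
    by apply: in_radicalD; [exact: cJ|exact: in_radicalM].
  have := rpredD (vU (lift ord0 i)) (rpredZ (c (lift ord0 i) ord0) wU).
  rewrite big_ord_recl scalerBr opprD addrACA -!addrA.
  rewrite [X in _ + X](_ : _ = - \sum_j (c (lift ord0 i) (lift ord0 j) +
      c (lift ord0 i) ord0 * s * c ord0 (lift ord0 j)) *: v (lift ord0 j)) //.
  rewrite addrCA addKr scaler_sumr -opprD -big_split /=; congr (- _).
  by apply: eq_bigr => j _; rewrite scalerDl !scalerA mulrA.
move=> i; case: (unliftP ord0 i) => [j ->|->]; first exact: vU'.
rewrite -(subrK (\sum_j (s * c ord0 (lift ord0 j)) *: v (lift ord0 j)) (v ord0)).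
by rewrite rpredD // rpred_sum // => j _; rewrite rpredZ.
Qed.

Lemma superfluous_radical V n (g : 'I_n -> V) (W : submodClosed V) :
  (forall x, exists c : 'I_n -> R, x = \sum_i c i *: g i) ->
  (forall w, w \in W -> exists c : 'I_n -> R,
     (forall i, in_radical (c i)) /\ w = \sum_i c i *: g i) ->
  superfluous W.
Proof.
move=> gV WJ U UW x; have [c ->] := gV x; apply: rpred_sum => i _.
apply: rpredZ; move: i.
have /choice[d dE] : forall i, exists d : 'I_n -> R,
    (forall j, in_radical (d j)) /\ g i - \sum_j d j *: g j \in U.
  move=> i; have [u [w [uU /WJ[d [dJ wE]] ->]]] := UW (g i).
  by exists d; split=> //; rewrite -wE addrK.
by apply: (@nakayama _ _ _ _ d) => [i|i]; case: (dE i).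
Qed.

Lemma superfluous_dual_basis P n (x : 'I_n -> P) (a : 'I_n -> hom P R^o)
    (W : submodClosed P) : dual_basis x a ->
  (forall i w, w \in W -> in_radical (a i w)) -> superfluous W.
Proof.
move=> xa WJ; apply: (@superfluous_radical _ _ x) => [y|w wW].
  by exists (fun i => a i y); exact: xa.
by exists (fun i => a i w); split=> [i|]; [exact: WJ|exact: xa].
Qed.

Lemma superfluous_dual P n (x : 'I_n -> P) (a : 'I_n -> hom P R^o)
    (W : submodClosed (hom P R^o)) : dual_basis x a ->
  (forall w, w \in W -> forall y, in_radical (w y)) -> superfluous W.
Proof.
move=> xa WJ; apply: (@superfluous_radical _ _ a) => [f|f fW].
  by exists (fun i => f (x i)); exact: dual_basis_dual.
by exists (fun i => f (x i)); split=> [i|]; [exact: WJ|exact: dual_basis_dual].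
Qed.

(** With [r = 1 - a * f x], the submodule of those [y] with [f y] in [r R] contains every
    [z - (a * f z) *: x], hence together with Ker [p] it generates [P]. By superfluity it is all of
    [P], so [f x = r * t] and [1 + a * t] inverts [r]. *)
Lemma cover_radical P X (p : {linear P -> X}) (f : {linear P -> R^o}) x :
  projective_cover p -> p x = 0 -> in_radical (f x).
Proof.
move=> [_ _ psup] px a; set r := 1 - a * f x.
pose S (y : P) := exists t, f y = r * t.
have S0 : S 0 by exists 0; rewrite linear0 mulr0.
have SD y z : S y -> S z -> S (y + z).
  by move=> [t yt] [u zu]; exists (t + u); rewrite linearD yt zu mulrDr.
have SZ b y : S y -> S (b *: y).
  by move=> [t yt]; exists (b * t); rewrite linearZ /= yt mulrCA.
have /submod_ofP[t tE] : x \in submod_of S0 SD SZ.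
  apply: psup => z.
  exists (z - (a * f z) *: x), ((a * f z) *: x); split; last by rewrite subrK.
    apply/submod_ofP; exists (f z); rewrite linearB linearZ /= /r mulrBl mul1r.
    by congr (_ - _); rewrite -[LHS]/(a * f z * f x) mulrAC.
  by apply/kernelP; rewrite linearZ /= px scaler0.
by exists (1 + a * t); rewrite mulrDr mulr1 mulrCA -tE /r subrK.
Qed.

Lemma finite_cover P X (p : {linear P -> X}) :
  projective_cover p -> finite_module X -> finite_module P.
Proof.
move=> [_ p_surj psup] [n [g gX]].
pose y i := sval (cid (p_surj (g i))).
have yE i : p (y i) = g i by exact: svalP (cid (p_surj (g i))).
have [I IP] := image_exists (row_combination y).
suff ys : surjective (row_combination y) by exact: finite_surj ys (finite_row _ n).
move=> z; apply/IP; move: z; apply: psup => z; have [c cE] := gX (p z).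
exists (\sum_i c i *: y i), (z - \sum_i c i *: y i); split; last by rewrite addrC subrK.
  apply/IP; exists (\row_i c i); rewrite row_combinationE.
  by apply: eq_bigr => i _; rewrite mxE.
apply/kernelP; rewrite linearB linear_sum cE.
by rewrite -sumrB big1 // => i _; rewrite linearZ /= yE subrr.
Qed.

(** A lift [f] of [p] is surjective because its image and Ker [p'] generate [P']. A section of [f]
    is surjective in the same way, by superfluity of Ker [p]. *)
Lemma projective_cover_unique P P' X (p : {linear P -> X}) (p' : {linear P' -> X}) :
  projective_cover p -> projective_cover p' ->
  exists f : {linear P -> P'}, bijective f /\ forall x, p' (f x) = p x.
Proof.
move=> [Pp ps psup] [Pp' ps' psup'].
have [f fE] := Pp _ _ p' p ps'; exists f; split; last exact: fE.
have [I IP] := image_exists f.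
have fs : surjective f.
  move=> y; apply/IP; move: y; apply: psup' => y; have [x xy] := ps (p' y).
  exists (f x), (y - f x); split; [by apply/IP; exists x| |by rewrite addrC subrK].
  by apply/kernelP; rewrite linearB -[p' (f x)]/((p' \o f) x) fE xy subrr.
have [s sK] := projective_section Pp' fs.
have [J JP] := image_exists s.
have ss x : exists y, s y = x.
  apply/JP; move: x; apply: psup => x.
  exists (s (f x)), (x - s (f x)); split; [by apply/JP; exists (f x)| |by rewrite addrC subrK].
  apply/kernelP; rewrite -[LHS]fE /= linearB sK subrr; exact: linear0.
exists s => // x; have [y <-] := ss x; by rewrite sK.
Qed.
End Radical.

(** * Semiperfect and Noetherian rings *)

Section Semiperfect.

Lemma nonunit_maximal (A : comNzRingType) (x : A) : ~ invertible x ->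
  exists m : submodClosed A^o, maximal_ideal m /\ x \in m.
Proof.
move=> xN; pose T := {W : submodClosed A^o | x \in W /\ (1 : A) \notin W}.
pose le (W W' : T) := `[< {subset sval W <= sval W'} >].
pose S (y : A^o) := exists a, y = a * x.
have S0 : S 0 by exists 0; rewrite mul0r.
have SD y z : S y -> S z -> S (y + z).
  by move=> [a ->] [b ->]; exists (a + b); rewrite mulrDl.
have SZ a y : S y -> S (a *: y) by move=> [b ->]; exists (a * b); rewrite -mulrA.
have t0 : T.
  exists (submod_of S0 SD SZ); split; first by apply/(submod_ofP S0 SD SZ); exists 1; rewrite mul1r.
  by apply/negP => /(submod_ofP S0 SD SZ)[a aE]; apply: xN; exists a; rewrite mulrC.
have [||chain tot|[m [xm m1]] mmax] := @classical_sets.ZL_preorder T t0 le.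
- by move=> W; apply/asboolP.
- by move=> W1 W2 W3 /asboolP W12 /asboolP W23; apply/asboolP => y /W12/W23.
(* A nonempty chain is bounded by its union; the empty chain is bounded by the principal ideal
   [t0]. *)
- have [[W0 cW0]|noW] := pselect (exists W, chain W); last first.
    by exists t0 => W cW; case: noW; exists W.
  pose Q (y : A^o) := exists2 W, chain W & y \in sval W.
  have Q0 : Q 0 by exists W0 => //; exact: rpred0.
  have QD y z : Q y -> Q z -> Q (y + z).
    move=> [W cW yW] [W' cW' zW'].
    have [/asboolP WW'|/asboolP WW'] := tot _ _ cW cW'.
      by exists W' => //; rewrite rpredD // WW'.
    by exists W => //; rewrite rpredD // WW'.
  have QZ a y : Q y -> Q (a *: y).
    by move=> [W cW yW]; exists W => //; exact: rpredZ.
  have QP : x \in submod_of Q0 QD QZ /\ (1 : A) \notin submod_of Q0 QD QZ.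
    split; first by apply/(submod_ofP Q0 QD QZ); exists W0 => //; case: (svalP W0).
    by apply/negP => /(submod_ofP Q0 QD QZ)[W _ W1]; have [_ /negP] := svalP W.
  exists (exist _ (submod_of Q0 QD QZ) QP) => W cW; apply/asboolP => y yW.
  by apply/(submod_ofP Q0 QD QZ); exists W.
exists m; split=> //; split=> // J mJ J1.
by have /asboolP := mmax (exist _ J (conj (mJ _ xm) J1)) (asboolT mJ).
Qed.

(** If neither [x] nor [1 - a * x] were a unit, both would lie in the unique maximal ideal, and so
    would 1. *)
Lemma local_ring_invertible (A : comNzRingType) (x : A) :
  local_ring A -> invertible x \/ in_radical x.
Proof.
move=> [m [[m1 _] m_uniq]]; have [|xN] := pselect (invertible x); first by left.
right=> a; apply: contrapT => yN.
have [m' [/m_uniq m'm xm']] := nonunit_maximal xN.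
have [m'' [/m_uniq m''m ym'']] := nonunit_maximal yN.
case/negP: m1.
have : (1 - a * x : A^o) + a *: (x : A^o) \in m.
  by apply: rpredD; [rewrite -m''m|apply: rpredZ; rewrite -m'm].
by rewrite -[_ + _]/(1 - a * x + a * x) subrK.
Qed.

(** The elementwise form in which semiperfectness is used: [e i] is the unit of the i-th local
    factor, and an element of that factor is either radical or a unit of it. *)
Lemma semiperfect_idempotents (R : comNzRingType) : semiperfect R ->
  exists n (e : 'I_n -> R), [/\ \sum_i e i = 1, forall i, e i * e i = e i
    & forall i r, in_radical (e i * r) \/ exists s, s * (e i * r) = e i].
Proof.
move=> [n [A [p [Aloc pb]]]].
have p_inj r s : (forall i, p i r = p i s) -> r = s.
  by move=> rs; have [t [_ tE]] := pb (fun i => p i s); rewrite -(tE r rs); exact: tE.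
have p_surj (a : forall i, A i) : exists r, forall i, p i r = a i.
  by have [r [rE _]] := pb a; exists r.
have /choice[e eE] : forall i, exists e, forall j, p j e = (j == i)%:R.
  by move=> i; exact: p_surj (fun j => (j == i)%:R).
have lift i (u : A i) (w : forall j, A j) : exists r, p i r = u /\ forall j, j != i -> p j r = w j.
  have [r rE] := p_surj (dfwith w u); exists r; split; first by rewrite rE dfwith_in.
  by move=> j ji; rewrite rE dfwith_out // eq_sym.
exists n, e; split=> [|i|i r].
- apply: p_inj => i; rewrite rmorph_sum rmorph1 (bigD1 i) //= eE eqxx big1 ?addr0 //.
  by move=> j ji; rewrite eE eq_sym (negPf ji).
- by apply: p_inj => j; rewrite rmorphM eE; case: eqP => _; rewrite ?mulr1 ?mulr0.
have [[u uE]|rJ] := local_ring_invertible (p i r) (Aloc i); [right|left].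
  have [s [si sj]] := lift i u (fun=> 0); exists s.
  apply: p_inj => j; rewrite !rmorphM eE; case: (eqVneq j i) => [->|ji].
    by rewrite si mul1r mulrC.
  by rewrite mul0r mulr0.
move=> a; have [u uE] := rJ (p i a).
(* Outside the i-th component [1 - a * (e i * r)] equals 1, so its inverse is 1 there and [u] in
   component [i]. *)
have [s [si sj]] := lift i u (fun=> 1); exists s.
apply: p_inj => j; rewrite rmorphM rmorphB !rmorphM !rmorph1 eE.
case: (eqVneq j i) => [->|ji]; first by rewrite si mul1r.
by rewrite mul0r mulr0 subr0 sj // mulr1.
Qed.

End Semiperfect.

(** * Submodules of finite modules over a Noetherian ring *)

Section Noetherian.
Variable R : comNzRingType.
Implicit Types P U V W X Y K : lmodType R.

(** Generators are indexed by any finite type, so that those of an extension can be indexed by a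
    disjoint sum. *)
Definition noetherian_module V : Prop := forall W : submodClosed V,
  exists (I : finType) (g : I -> V), (forall i, g i \in W) /\
    (forall x, x \in W -> exists c : I -> R, x = \sum_i c i *: g i).

Lemma noetherian_module_exact V' V V'' (i : {linear V' -> V}) (q : {linear V -> V''}) :
  exact i q -> noetherian_module V' -> noetherian_module V'' -> noetherian_module V.
Proof.
move=> iq V'n V''n W.
have [I IP] := image_exists (q \o (val : {linear submodule W -> V})).
have [J JP] := preimage_exists i W.
have [S [g [gI gP]]] := V''n I; have [T [h [hJ hP]]] := V'n J.
have /choice[k kE] : forall s, exists x : submodule W, q (val x) = g s.
  by move=> s; apply/IP.
exists (S + T)%type.
exists (fun st => match st with inl s => val (k s) | inr t => i (h t) end).
split=> [[s|t]|x xW]; [exact: (valP (k s))|exact/JP|].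
have /gP[c cE] : q x \in I by apply/IP; exists (Sub x xW).
have /iq[v vE] : q (x - \sum_s c s *: val (k s)) = 0.
  rewrite linearB linear_sum cE -sumrB big1 // => s _.
  by rewrite linearZ /= kE subrr.
have /hP[d dE] : v \in J.
  apply/JP; rewrite vE rpred_submodB // rpred_sum // => s _; rewrite rpredZ //.
  exact: (valP (k s)).
exists (fun st => match st with inl s => c s | inr t => d t end).
rewrite big_sumType /= addrC -[LHS](subrK (\sum_s c s *: val (k s))) -vE; congr (_ + _).
by rewrite dE linear_sum; apply: eq_bigr => t _; rewrite linearZ.
Qed.

Lemma noetherian_module_surj U V (f : {linear U -> V}) :
  surjective f -> noetherian_module U -> noetherian_module V.
Proof.
move=> fs Un W; have [J JP] := preimage_exists f W.
have [I [g [gJ gP]]] := Un J; exists I, (f \o g).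
split=> [i|y yW]; first exact/JP.
have [x xy] := fs y; have /gP[c cE] : x \in J by apply/JP; rewrite xy.
by exists c; rewrite -xy cE linear_sum; apply: eq_bigr => i _; rewrite linearZ.
Qed.

Lemma noetherian_row n : noetherian R -> noetherian_module 'rV[R]_n.
Proof.
move=> Rn; elim: n => [|n IHn].
  move=> W; exists 'I_0, (fun=> 0); split=> [[]//|x _].
  by exists (fun=> 0); apply/rowP => -[].
have Rm : noetherian_module R^o.
  by move=> W; have [m [g gP]] := Rn W; exists 'I_m, g.
have il : linear (fun a : R^o => (a : R) *: delta_mx 0 0 : 'rV[R]_n.+1).
  by move=> a x y; rewrite scalerDl scalerA.
have ql : linear (fun v : 'rV[R]_n.+1 => \row_j v 0 (lift ord0 j)).
  by move=> a x y; apply/rowP => j; rewrite !mxE.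
apply: (@noetherian_module_exact _ _ _ (linear_of il) (linear_of ql)) Rm IHn => v.
split=> [/rowP v0|[a <-]]; last by apply/rowP => j; rewrite !mxE /= mulr0.
exists (v 0 0); apply/rowP => j; rewrite !mxE eqxx /=.
case: (unliftP ord0 j) => [k ->|->]; last by rewrite mulr1.
by rewrite mulr0; have := v0 k; rewrite !mxE.
Qed.

Lemma finite_submodule V (W : submodClosed V) :
  noetherian R -> finite_module V -> finite_module (submodule W).
Proof.
move=> Rn [n [g gV]].
have Vn := noetherian_module_surj (row_combination_surj gV) (@noetherian_row n Rn).
have [I [h [hW hP]]] := Vn W.
apply: (@finite_indexed _ I _ (fun i => Sub (h i) (hW i) : submodule W)) => x.
have [c cE] := hP _ (valP x); exists c; apply: val_inj; rewrite [LHS]cE.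
rewrite (linear_sum (val : {linear submodule W -> V})).
by apply: eq_bigr => i _; rewrite linearZ.
Qed.
End Noetherian.

(** * Existence of projective covers over a semiperfect ring *)

Section Covers.
Variable R : comNzRingType.
Implicit Types P U V W X Y K : lmodType R.

Lemma finite_projective_cover K : semiperfect R -> finite_module K ->
  exists P (p : {linear P -> K}), projective_cover p.
Proof.
move=> /semiperfect_idempotents[n [e [e1 ee eP]]] [k [g gK]].
pose G m := exists (c : 'I_m -> 'I_n) (y : 'I_m -> K),
  (forall a, e (c a) *: y a = y a) /\
  forall x, exists d : 'I_m -> R, x = \sum_a d a *: y a.
have exG : exists m, `[< G m >].
  exists #|{: 'I_n * 'I_k}|; apply/asboolP.
  exists (fun a => (enum_val a).1), (fun a => e (enum_val a).1 *: g (enum_val a).2).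
  split=> [a|x]; first by rewrite scalerA ee.
  have [d dE] := gK x; exists (fun a => d (enum_val a).2).
  rewrite -(reindex (@enum_val _ {: 'I_n * 'I_k}) (P := predT)
    (F := fun ij => d ij.2 *: (e ij.1 *: g ij.2))) /=; last first.
    by apply: onW_bij; exact: enum_val_bij.
  rewrite -(pair_big predT predT (fun i j => d j *: (e i *: g j))) /= exchange_big /= dE.
  apply: eq_bigr => j _; rewrite -scaler_sumr -scaler_suml e1 scale1r //.
case: (ex_minnP exG) => m /asboolP[c [y [yc yK]]] m_min.
(* If [t a] were not radical, the relation [t] would make [y a] redundant. *)
have min_radical (t : 'I_m -> R) a :
    \sum_b t b *: y b = 0 -> t a = e (c a) * t a -> in_radical (t a).
  move=> ty0 ta; rewrite ta; case: (eP (c a) (t a)) => // -[s]; rewrite -ta => sE.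
  case: m c y yc yK m_min t a ty0 {ta} sE => [|m] c y yc yK m_min t a ty0 sE.
    by case: a {sE}.
  suff /asboolP/m_min : G m by rewrite ltnn.
  exists (c \o lift a), (y \o lift a); split=> [b|z]; first exact: yc.
  have [d dE] := yK z; exists (fun b => d (lift a b) - d a * s * t (lift a b)).
  have := congr1 (fun z => s *: z) ty0.
  rewrite scaler0 scaler_sumr (bigD1_ord a) //= scalerA sE yc => /eqP.
  rewrite addr_eq0 => /eqP yaE.
  rewrite dE (bigD1_ord a) //= yaE scalerN scaler_sumr addrC -sumrB.
  by apply: eq_bigr => b _; rewrite scalerBl !scalerA mulrA.
have fl : linear (fun v : 'rV[R]_m => \row_a (v 0 a - e (c a) * v 0 a)).
  by move=> b u v; apply/rowP => a; rewrite !mxE mulrDr opprD addrACA mulrBr mulrCA.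
(* [P] is the direct sum of the [R e (c a)], cut out of the free module as the rows fixed by the
   idempotents. *)
have [P [i [i_inj iP]]] := kernel_exists (linear_of fl).
have el : linear (fun v : 'rV[R]_m => \row_a (e (c a) * v 0 a)).
  by move=> b u v; apply/rowP => a; rewrite !mxE mulrDr mulrCA.
have [v|r rE] := @factor_inj _ _ _ _ i (linear_of el) i_inj.
  by apply/iP/rowP => a; rewrite !mxE mulrA ee subrr.
have iE x a : i x 0 a = e (c a) * i x 0 a.
  have /rowP/(_ a) : linear_of fl (i x) = 0 by apply/iP; exists x.
  by rewrite !mxE => /eqP; rewrite subr_eq0 => /eqP.
have iK : cancel i r.
  by move=> x; apply: i_inj; rewrite rE; apply/rowP => a; rewrite mxE -iE.
exists P, (row_combination y \o i); split.
- by apply: (retract_projective _ (@projective_row _ m)); exists i, r.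
- move=> x; have [v vE] := row_combination_surj yK x; exists (r v).
  rewrite -vE -[LHS]/(row_combination y (i (r v))) rE !row_combinationE.
  by apply: eq_bigr => a _; rewrite mxE mulrC -scalerA yc.
apply: (@superfluous_radical _ _ _ (fun a => r (delta_mx 0 a))) => [x|x /kernelP x0].
  exists (i x 0); rewrite -[LHS]iK {1}(row_sum_delta (i x)) linear_sum.
  by apply: eq_bigr => a _; rewrite linearZ.
exists (i x 0); split; last first.
  rewrite -[LHS]iK {1}(row_sum_delta (i x)) linear_sum.
  by apply: eq_bigr => a _; rewrite linearZ.
move=> a; apply: min_radical; last by rewrite -iE.
by rewrite -[LHS]/(row_combination y (i x)) in x0 *; exact: x0.
Qed.

End Covers.
(** * Stable modules *)

Section StableRadical.
Variable R : comNzRingType.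
Implicit Types P U V W X Y K M : lmodType R.

Lemma split_isomorphic M P (f : {linear M -> P}) : projective P -> surjective f ->
  exists K, isomorphic M (P * K)%type.
Proof.
move=> Pp fs; have [s sK] := projective_section Pp fs.
have [K [i [i_inj iP]]] := kernel_exists f; exists K.
have fi x : f (i x) = 0 by apply/iP; exists x.
have gl : linear (fun x : P * K => s x.1 + i x.2).
  by move=> a x y; rewrite /= !linearP scalerDr addrACA.
have [|g [gK g'K]] := @linear_inverse _ _ _ (linear_of gl).
  apply: inj_surj_bij => [|m].
    apply: linear_inj => -[x y] /= xy0.
    have x0 : x = 0 by have := congr1 f xy0; rewrite linearD sK fi addr0 linear0.
    congr (_, _) => //; apply: i_inj; rewrite linear0.
    by move: xy0; rewrite x0 linear0 add0r.
  have /iP[y yE] : f (m - s (f m)) = 0 by rewrite linearB sK subrr.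
  by exists (f m, y); rewrite /= yE addrC subrK.
by exists g; exact: Bijective g'K gK.
Qed.

Lemma projective_regular : projective R^o.
Proof.
move=> U V g f gs; have [u uE] := gs (f (1 : R)).
have hl : linear (fun r : R^o => (r : R) *: u).
  by move=> a x y; rewrite scalerDl scalerA.
exists (linear_of hl) => r /=; rewrite linearZ /= uE -linearZ; congr (f _).
exact: mulr1.
Qed.

(** If [e i * f x] is not radical, it divides [e i], so [M] maps onto the projective module [R e i],
    which then splits off. Stability makes this summand zero, and [e i * f x = 0]. *)
Lemma stable_radical M (f : {linear M -> R^o}) x :
  semiperfect R -> stable M -> in_radical (f x).
Proof.
move=> /semiperfect_idempotents[n [e [e1 ee eP]]] [_ Mstable].
suff efJ i : in_radical (e i * f x).
  rewrite -[f x](mul1r (f x : R)) -e1 mulr_suml.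
  by apply: in_radical_sum.
have [//|[s sE]] := eP i (f x).
have kl : linear (fun r : R^o => (r - e i * r : R) : R^o).
  by move=> a u v; rewrite mulrDr opprD addrACA -[RHS]/(a * (u - e i * u) + _) mulrBr mulrCA.
have [P [j [j_inj jP]]] := kernel_exists (linear_of kl).
have el : linear (fun r : R^o => (e i * r : R) : R^o).
  by move=> a u v; rewrite mulrDr -[_ *: _]/(a * _) mulrCA.
have [r|q qE] := @factor_inj _ _ _ _ j (linear_of el) j_inj.
  by apply/jP; rewrite /= mulrA ee subrr.
have jE y : j y = e i * j y :> R.
  have /eqP : linear_of kl (j y) = 0 by apply/jP; exists y.
  by rewrite subr_eq0 => /eqP.
have Pp : projective P.
  apply: (retract_projective _ projective_regular); exists j, q => y.
  by apply: j_inj; rewrite qE /= -jE.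
have qfs : surjective (q \o f).
  move=> y; exists (((j y : R) * s) *: x); apply: j_inj; rewrite /= qE linearZ /=.
  rewrite -[_ *: f x]/((j y : R) * s * (f x : R)).
  by rewrite mulrCA -mulrA sE mulrC -jE.
have [K /(Mstable _ _ Pp) P0] := split_isomorphic Pp qfs.
have : j (q (f x)) = 0 by rewrite (P0 (q (f x))) linear0.
by rewrite qE /= => ->; exact: in_radical0.
Qed.
End StableRadical.

(** * Homomorphisms out of a faithful finite module *)

Section McCoy.
Variable R : comNzRingType.

(* McCoy's argument: a relation matrix of C has its n x n minors in the
   annihilator of C, which is zero; the cofactors of a largest minor that does
   not kill k then define a nonzero linear map C -> K. *)
Lemma faithful_hom_zero (C K : lmodType R) : finite_module C ->
  (forall r : R, (forall c : C, r *: c = 0) -> r = 0) ->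
  (forall h : {linear C -> K}, forall c, h c = 0) -> forall k : K, k = 0.
Proof.
move=> [n [g gC]] Cfaithful homCK k; apply: contrapT => k0.
pose rel (v : 'I_n -> R) := \sum_j v j *: g j = 0.
pose minors_vanish r := forall (B : 'I_r -> 'I_n -> R) (f : 'I_r -> 'I_n),
  (forall a, rel (B a)) -> \det (\matrix_(a, b) B a (f b)) *: k = 0.
have mn : minors_vanish n.
  move=> B f Brel; pose M : 'M[R]_n := \matrix_(a, j) B a j.
  have -> : \matrix_(a, b) B a (f b) = M *m \matrix_(j, b) (j == f b)%:R.
    apply/matrixP => a b; rewrite !mxE (bigD1 (f b)) //= !mxE eqxx mulr1.
    by rewrite big1 ?addr0 // => j jb; rewrite !mxE (negPf jb) mulr0.
  rewrite det_mulmx (Cfaithful (\det M)) ?mul0r ?scale0r // => c.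
  have [d ->] := gC c; rewrite scaler_sumr big1 // => j _.
  rewrite scalerA mulrC -scalerA -[RHS](scaler0 _ (d j)); congr (_ *: _).
  (* Cramer's rule: the adjugate writes [\det M *: g j] as a combination of relations, so [\det M]
     annihilates [C]. *)
  have -> : \det M *: g j = \sum_l (\adj M *m M) j l *: g l.
    rewrite mul_adj_mx (bigD1 j) //= !mxE eqxx big1 ?addr0 // => l lj.
    by rewrite !mxE eq_sym (negPf lj) scale0r.
  under eq_bigr do rewrite mxE scaler_suml.
  rewrite exchange_big big1 //= => a _.
  transitivity (\adj M j a *: \sum_l B a l *: g l).
    by rewrite scaler_sumr; apply: eq_bigr => l _; rewrite scalerA [M a l]mxE.
  by rewrite (Brel a) scaler0.
have exr : exists r, `[< minors_vanish r >] by exists n; apply/asboolP.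
case: (ex_minnP exr) => -[|m] /asboolP mv m_min.
  (* For size 0 the empty minor is 1, which would give [k = 0]. *)
  case: k0; have f0 (a : 'I_0) : 'I_n by case: a.
  have := mv (fun=> fun=> 0) f0.
  by rewrite det_mx00 scale1r; apply; case.
have mn' : (m < n)%N by apply/m_min/asboolP.
have [B [f [Brel Bf]]] : exists (B : 'I_m -> 'I_n -> R) (f : 'I_m -> 'I_n),
    (forall a, rel (B a)) /\ \det (\matrix_(a, b) B a (f b)) *: k <> 0.
  apply: contrapT => noB; suff /asboolP/m_min : minors_vanish m by rewrite ltnn.
  by move=> B f Brel; apply: contrapT => Bf; apply: noB; exists B, f.
have [j0 j0f] : exists j0, forall a, f a != j0.
  apply: contrapT => nj0; have : (#|'I_n| <= #|'I_m|)%N.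
    apply: leq_trans (leq_image_card f _); rewrite -cardsT; apply/subset_leq_card.
    apply/subsetP => j _; apply: contrapT => jf; apply: nj0; exists j => a.
    by apply/eqP => fa; apply: jf; rewrite -fa; apply/imageP; exists a.
  by rewrite !card_ord leqNgt mn'.
(* Border the nonvanishing minor with the column [j0] missed by [f] and a variable row [v].
   Expanding along that row makes the bordered minor times [k] a linear function of [v], with
   coefficients [w]. *)
pose f' (b : 'I_m.+1) := if unlift ord0 b is Some b' then f b' else j0.
pose B' v (a : 'I_m.+1) := if unlift ord0 a is Some a' then B a' else v : 'I_n -> R.
pose D v : 'M[R]_m.+1 := \matrix_(a, b) B' v a (f' b).
pose w j := \sum_(b | f' b == j) cofactor (D (fun=> 0)) ord0 b *: k.
have wE v : row_combination w v = \det (D (v 0)) *: k.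
  rewrite row_combinationE (expand_det_row _ ord0) scaler_suml.
  rewrite [RHS](partition_big f' predT) //=; apply: eq_bigr => j _.
  rewrite scaler_sumr; apply: eq_bigr => b /eqP <-.
  rewrite scalerA mxE /B' unlift_none; congr (_ * (_ * \det _) *: _).
  by apply/matrixP => a c; rewrite !mxE /B' liftK.
(* On a relation [v] the bordered minor has size [m.+1] and kills [k]; so [w] defines a map [h] from
   [C] to [K]. *)
have [v|h hE] := @factor_surj _ _ _ _ (row_combination g) (row_combination w)
    (row_combination_surj gC).
  move=> v0; rewrite wE; apply: mv => a; rewrite /B'.
  by case: (unlift ord0 a) => [a'|]; [exact: Brel|exact: v0].
(* Since [f] misses [j0], the value of [h] at [g j0] is exactly the chosen minor times [k]. *)
apply: Bf; have := hE (delta_mx 0 j0); rewrite homCK row_combination_delta => ->.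
rewrite /w (big_pred1 ord0) => [|b]; last first.
  case: (unliftP ord0 b) => [b' ->|->]; rewrite /= /f' ?liftK ?unlift_none ?eqxx //.
  by rewrite (negPf (j0f b')) eq_sym (negPf (neq_lift _ _)).
rewrite /cofactor expr0 mul1r; congr (\det _ *: _).
by apply/matrixP => a b; rewrite !mxE /B' /f' !liftK.
Qed.
End McCoy.

(** * Linkage *)

Section Presentation.
Variable R : comNzRingType.
Implicit Types P K M L T : lmodType R.

Lemma minimal_presentation_exact P1 P0 M (f : {linear P1 -> P0}) (p : {linear P0 -> M}) :
  minimal_presentation f p -> exact f p.
Proof.
move=> [_ [K [i [g [[i_inj ip] [_ gs _] fE]]]]] y.
rewrite ip; split=> [[x <-]|[x <-]]; last by exists (g x); rewrite fE.
by have [z <-] := gs x; exists z; rewrite fE.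
Qed.

Lemma minimal_presentation_finite P1 P0 M (f : {linear P1 -> P0}) (p : {linear P0 -> M}) :
  noetherian R -> finite_module M -> minimal_presentation f p ->
  [/\ projective P1, projective P0, finite_module P1 & finite_module P0].
Proof.
move=> Rn Mf [pc [K [i [g [[i_inj ip] gc fE]]]]]; have P0f := finite_cover pc Mf.
have [P0p _ _] := pc; have [P1p _ _] := gc; split=> //.
apply: finite_cover gc _.
have [x|k kE] := @factor_inj _ _ _ _ i (kernel_incl p) i_inj.
  by apply/ip/(kernel_inclP p).2; exists x.
apply: (@finite_surj _ _ _ k); last exact: finite_submodule.
move=> y; have /(kernel_inclP p).2[x xE] : p (i y) = 0 by apply/ip; exists y.
by exists x; apply: i_inj; rewrite kE.
Qed.

Lemma minimal_presentation_radical P1 P0 M (f : {linear P1 -> P0}) (p : {linear P0 -> M})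
    (phi : {linear P0 -> R^o}) x : minimal_presentation f p -> in_radical (phi (f x)).
Proof.
move=> fp; apply: cover_radical (proj1 fp) _.
by apply/(minimal_presentation_exact fp); exists x.
Qed.

(** Ker [q] is the image of [f^*], and its elements [phi \o f] take radical values because the image
    of [f] is the kernel of the cover [p]. *)
Lemma transpose_cover P1 P0 M T (f : {linear P1 -> P0}) (p : {linear P0 -> M})
    (q : {linear hom P1 R^o -> T}) :
  noetherian R -> finite_module M -> minimal_presentation f p ->
  is_cokernel (hom_pre R^o f) q -> projective_cover q.
Proof.
move=> Rn Mf fp [qs fq].
have [P1p _ P1f _] := minimal_presentation_finite Rn Mf fp.
split=> //; first exact: projective_dual.
have [n [x [a xa]]] := dual_basis_exists P1p P1f.
apply: (superfluous_dual xa) => w /kernelP/fq[phi <-] y.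
exact: minimal_presentation_radical fp.
Qed.

(** [is_lambda] allows any projective cover of the transpose; uniqueness of covers replaces it by
    the dual of [P1], and [L] becomes the image of [f^*], with [j] the inclusion and [r] the
    corestriction. *)
Lemma lambda_embedding M L : noetherian R -> finite_module M -> is_lambda M L ->
  exists P1 P0 (f : {linear P1 -> P0}) (p : {linear P0 -> M})
    (j : {linear L -> hom P1 R^o}) (r : {linear hom P0 R^o -> L}),
    [/\ minimal_presentation f p, injective j, surjective r
      & forall phi, j (r phi) = hom_pre R^o f phi].
Proof.
move=> Rn Mf [T [Q [q [i [[P1 [P0 [f [p [q0 [fp q0c]]]]]] qc [i_inj iq]]]]]].
have [g [gb gE]] := projective_cover_unique qc (transpose_cover Rn Mf fp q0c).
have j_inj : injective (g \o i) by exact: inj_comp (bij_inj gb) i_inj.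
have [phi|r rE] := @factor_inj _ _ _ _ (g \o i) (hom_pre R^o f) j_inj.
  have [x xE] := bij_surj gb (hom_pre R^o f phi).
  have /iq[l lE] : q x = 0 by rewrite -gE xE; apply/q0c.2; exists phi.
  by exists l; rewrite /= lE.
exists P1, P0, f, p, (g \o i), r; split=> // l.
have /q0c.2[phi phiE] : q0 (g (i l)) = 0 by rewrite gE; apply/iq; exists l.
by exists phi; apply: j_inj; rewrite rE phiE.
Qed.
End Presentation.

(** * Pure tensors, and duality of finite projective modules *)

Section TensorFacts.
Variable R : comNzRingType.

(** The projection modulo [W] agrees with the zero map on pure tensors, hence everywhere. *)
Lemma tensor_span (M N : lmodType R) (W : submodClosed (tensor M N)) :
  (forall x y, tens x y \in W) -> forall t, t \in W.
Proof.
move=> xyW t; rewrite -[t]subr0; apply/quotient_piP.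
rewrite -[quotient_pi _ _]/((quotient_pi W : {linear _ -> _}) t)
  -[RHS]/((quotient_pi W : {linear _ -> _}) 0).
rewrite linear0; move: t; apply: (@tensor_ext _ _ _ _ (quotient_pi W) \0) => x y /=.
rewrite -[RHS](linear0 (quotient_pi W)); apply/quotient_piP.
by rewrite subr0.
Qed.

Lemma finite_hom_separates (P C : lmodType R) :
  projective P -> finite_module P ->
  (forall r : R, (forall c : C, r *: c = 0) -> r = 0) ->
  forall y : P, (forall psi : hom P C, psi y = 0) -> y = 0.
Proof.
move=> Pp Pf Cfaithful y y0; have [n [x [a xa]]] := dual_basis_exists Pp Pf.
rewrite (xa y) big1 // => i _; rewrite (Cfaithful (a i y)) ?scale0r // => c.
have cl : linear (fun z => (a i z : R) *: c).
  by move=> k u v; rewrite linearP scalerDl scalerA.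
exact: y0 (linear_of cl).
Qed.

(** On the maps sending [z] to [a i z *: c], with [c] in [C], [h] is an endomorphism of [C], hence a
    homothety [b i]. The point is the sum of the [b i *: x i]. *)
Lemma finite_hom_bidual (P C : lmodType R) (h : {linear hom P C -> C}) :
  projective P -> finite_module P ->
  (forall g : hom C C, exists a : R, forall c, g c = a *: c) ->
  exists y, forall psi, h psi = psi y.
Proof.
move=> Pp Pf C_homothety; have [n [x [a xa]]] := dual_basis_exists Pp Pf.
have ml i (c : C) : linear (fun z => (a i z : R) *: c).
  by move=> k u v; rewrite linearP scalerDl scalerA.
have mll i : linear (fun c => linear_of (ml i c) : hom P C).
  by move=> k c d; apply: hom_ext => z; rewrite /= scalerDr !scalerA mulrC.
have /choice[b bE] : forall i, exists b : R, forall c, h (linear_of (mll i) c) = b *: c.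
  by move=> i; exact: C_homothety (h \o linear_of (mll i)).
exists (\sum_i b i *: x i) => psi.
have -> : psi = \sum_i linear_of (mll i) (psi (x i)).
  by apply: hom_ext => z; rewrite hom_sumE (dual_basis_hom _ xa).
rewrite linear_sum linear_sum; apply: eq_bigr => i _.
rewrite bE linearZ; congr (_ *: _); rewrite hom_sumE.
exact: dual_basis_hom.
Qed.
End TensorFacts.

(** * Total reflexivity of the tensor product *)

Section GorensteinLinkage.
Variables (R : comNzRingType) (C M L P1 P0 : lmodType R).
Variables (f : {linear P1 -> P0}) (p : {linear P0 -> M}).
Variables (j : {linear L -> hom P1 R^o}) (r : {linear hom P0 R^o -> L}).
Hypotheses (C_finite : finite_module C)
  (C_faithful : forall a : R, (forall c : C, a *: c = 0) -> a = 0)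
  (C_homothety : forall h : hom C C, exists a : R, forall c, h c = a *: c)
  (C_ext : forall n, ext_vanish C n C).
Hypotheses (P0_proj : projective P0) (P0_fin : finite_module P0)
  (p_surj : surjective p) (fp : exact f p).
Hypotheses (M_bidual : bijective (@biduality R C M))
  (M_ext : forall n, ext_vanish C n M) (MC_ext : forall n, ext_vanish C n (hom M C)).
Hypotheses (j_inj : injective j) (r_surj : surjective r)
  (jr : forall phi, j (r phi) = hom_pre R^o f phi).
Hypothesis L_unit : forall h : hom C (tensor L C), exists l, forall c, h c = tens l c.

(** Towards [tau]: the map [j] tensored with [C], followed by the evaluation of the dual of [P1]
    tensored with [C] in Hom(P1, C). *)
Let tau_fun (l : L) (c : C) (x : P1) : C := (j l x : R) *: c.
Let tau_fun_linear l c : linear (tau_fun l c).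
Proof. by move=> a x y; rewrite /tau_fun linearP scalerDl scalerA. Qed.
Let tau_bi l c : hom P1 C := linear_of (@tau_fun_linear l c).
Let tau_l c : linear (tau_bi^~ c).
Proof.
move=> a l l'; apply: hom_ext => x; rewrite /= /tau_fun linearP.
by rewrite -[(_ + _ : hom _ _) x]/(a * j l x + j l' x) scalerDl scalerA.
Qed.
Let tau_r l : linear (tau_bi l).
Proof.
move=> a c c'; apply: hom_ext => x; rewrite /= /tau_fun scalerDr.
by rewrite !scalerA mulrC.
Qed.
Let tau : {linear tensor L C -> hom P1 C} := tensor_lift tau_l tau_r.
Let tauE l c x : tau (tens l c) x = (j l x : R) *: c.
Proof. by rewrite /tau tensor_liftE. Qed.

(** A map from [C] to the kernel [K] has the form [tens l c] by [L_unit]. As [tau] kills it, each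
    [j l x] annihilates [C], so [l = 0]. Hence Hom(C, K) = 0 and [K = 0]. *)
Let tau_inj : injective tau.
Proof.
have [K [k [k_inj kP]]] := kernel_exists tau.
suff K0 : forall x : K, x = 0.
  apply: linear_inj => t /kP[x <-]; by rewrite (K0 x) linear0.
apply: (faithful_hom_zero C_finite C_faithful) => h c.
have [l lE] := L_unit (k \o h).
suff l0 : l = 0.
  apply: k_inj; rewrite -[LHS]/((k \o h) c) lE l0 linear0.
  exact: (linear0 (linear_of (@tens_linearl R L C c))).
apply: j_inj; rewrite linear0; apply: hom_ext => x; apply: C_faithful => d.
by rewrite -tauE -lE; have -> : tau ((k \o h) d) = 0 by apply/kP; exists (h d).
Qed.

(** [sigma] is [r] tensored with [C], once Hom(P0, C) is identified with the dual of [P0] tensored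
    with [C] by a dual basis. *)
Let sigma_exists : exists sigma : {linear hom P0 C -> tensor L C},
  surjective sigma /\ forall psi x, tau (sigma psi) x = psi (f x).
Proof.
have [n [x [a xa]]] := dual_basis_exists P0_proj P0_fin.
have sl : linear (fun psi : hom P0 C => \sum_k tens (r (a k)) (psi (x k))).
  move=> c psi psi'; rewrite scaler_sumr -big_split; apply: eq_bigr => k _.
  exact: tens_linearr.
have sE psi y : tau (linear_of sl psi) y = psi (f y).
  rewrite (dual_basis_hom _ xa) linear_sum hom_sumE; apply: eq_bigr => k _.
  by rewrite tauE jr.
exists (linear_of sl); split=> //.
have [I IP] := image_exists (linear_of sl).
move=> t; apply/IP; move: t; apply: tensor_span => l c; apply/IP.
have [phi <-] := r_surj l.
have pl : linear (fun y => (phi y : R) *: c).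
  by move=> k u v; rewrite linearP scalerDl scalerA.
exists (linear_of pl); apply: tau_inj; apply: hom_ext => y.
by rewrite sE tauE jr.
Qed.

Let sigma : {linear hom P0 C -> tensor L C} := sval (cid sigma_exists).
Let sigma_surj : surjective sigma.
Proof. by have [] := svalP (cid sigma_exists). Qed.
Let tau_sigma psi x : tau (sigma psi) x = psi (f x).
Proof. by have [_] := svalP (cid sigma_exists); apply. Qed.

Let sigma_short_exact : short_exact (hom_pre C p) sigma.
Proof.
split=> //; split=> [g g' gg'|psi].
  apply: hom_ext => m; have [x <-] := p_surj m.
  by rewrite -[LHS]/(hom_pre C p g x) gg'.
split=> [psi0|[g <-]].
  have [x /fp[y <-]|g gE] := @factor_surj _ _ _ _ p psi p_surj.
    by rewrite -tau_sigma psi0 linear0.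
  by exists g; apply: hom_ext => x; exact: gE.
apply: tau_inj; rewrite linear0; apply: hom_ext => x; rewrite tau_sigma /=.
by have -> : p (f x) = 0; [apply/fp; exists x|exact: linear0].
Qed.

Lemma lambda_tensor_finite : finite_module (tensor L C).
Proof. exact: finite_surj sigma_surj (finite_hom P0_proj P0_fin C_finite). Qed.

Lemma lambda_tensor_ext n : ext_vanish C n (tensor L C).
Proof.
apply: ext_vanish_cokernel sigma_short_exact _ MC_ext _ => [h|m]; last first.
  exact: ext_vanish_hom.
(* By reflexivity a map from Hom(M, C) to [C] is evaluation at some [p x]; evaluation at [x] extends
   it to Hom(P0, C). *)
have [b bK Kb] := M_bidual; have [x xE] := p_surj (b h).
by exists (biduality C x) => g /=; rewrite -[h]Kb -xE.
Qed.

(** Through [sigma], [h] becomes evaluation at some [y] in [P0]. It vanishes on Hom(M, C), so every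
    map from [M] to [C] kills [p y]; injectivity of biduality gives [p y = 0], and [y] lies in the
    image of [f]. *)
Let hom_tensor (h : {linear tensor L C -> C}) : exists x, forall t, h t = tau t x.
Proof.
have [y yE] := finite_hom_bidual (h \o sigma) P0_proj P0_fin C_homothety.
have [x xE] : exists x, f x = y.
  apply/fp; apply: (bij_inj M_bidual); apply: hom_ext => g.
  rewrite /= /biduality_fun linear0 -[LHS]/(hom_pre C p g y) -yE /=.
  have -> : sigma (hom_pre C p g) = 0 by apply/sigma_short_exact.1.2; exists g.
  exact: linear0.
exists x => t; have [psi <-] := sigma_surj t.
by rewrite tau_sigma xE -yE.
Qed.

(** Apply the preceding fact to the map sending [tens l c] to [h l *: c], then cancel [c] by
    faithfulness of [C]. *)
Lemma lambda_dual (h : {linear L -> R^o}) : exists x, forall l, h l = j l x.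
Proof.
have hl (c : C) : linear (fun l => (h l : R) *: c).
  by move=> k u v; rewrite linearP scalerDl scalerA.
have hr l : linear (fun c : C => (h l : R) *: c).
  by move=> k u v; rewrite scalerDr !scalerA mulrC.
have [x xE] := hom_tensor (tensor_lift hl hr); exists x => l.
apply/eqP; rewrite -subr_eq0; apply/eqP/C_faithful => c.
by rewrite scalerBl -tauE -xE tensor_liftE subrr.
Qed.

(** The syzygy Ker [p] is the image of [f], and [f x] acts on the tensor product as evaluation of
    [tau] at [x]. This is injective because maps to [C] separate the points of [P0]. *)
Let kappa_exists (K : lmodType R) (i : {linear K -> P0}) : is_kernel i p ->
  exists k : {linear K -> hom (tensor L C) C},
    bijective k /\ forall y x t, i y = f x -> k y t = tau t x.
Proof.
move=> [i_inj ip].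
have [x|g gE] := @factor_inj _ _ _ _ i f i_inj.
  by apply/ip/fp; exists x.
have g_surj : surjective g.
  move=> y; have /fp[x xE] : p (i y) = 0 by apply/ip; exists y.
  by exists x; apply: i_inj; rewrite gE.
have evl x : linear (fun t => tau t x) by move=> a t u; rewrite linearP.
have evll : linear (fun x => linear_of (evl x) : hom (tensor L C) C).
  by move=> a x y; apply: hom_ext => t; rewrite /= linearP.
have tau0 x t : f x = 0 -> tau t x = 0.
  by move=> fx; have [psi <-] := sigma_surj t; rewrite tau_sigma fx linear0.
have [x gx|k kE] := @factor_surj _ _ _ _ g (linear_of evll) g_surj.
  by apply: hom_ext => t; apply: tau0; rewrite -gE gx linear0.
exists k; split; last first.
  move=> y x t iy; have -> : y = g x by apply: i_inj; rewrite gE.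
  by rewrite kE.
apply: inj_surj_bij => [|h].
  apply: linear_inj => y; have [x <-] := g_surj y; rewrite kE => x0.
  apply: i_inj; rewrite gE linear0.
  apply: (finite_hom_separates P0_proj P0_fin C_faithful) => psi.
  by rewrite -tau_sigma -[LHS]/(linear_of evll x (sigma psi)) x0.
have [x xE] := hom_tensor h; exists (g x); rewrite kE.
by apply: hom_ext => t; rewrite xE.
Qed.

Lemma hom_lambda_tensor_ext n : ext_vanish C n (hom (tensor L C) C).
Proof.
have [K [i ip]] := kernel_exists p.
have [k [/linear_inverse[k' [_ kK]] _]] := kappa_exists ip.
apply: (@ext_vanish_retract _ _ _ _ K); first by exists k', k.
exact: (M_ext n.+1 _ _ _ _ P0_proj (conj ip p_surj)).
Qed.

Lemma lambda_tensor_bidual : bijective (@biduality R C (tensor L C)).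
Proof.
have bl : linear (@biduality R C (tensor L C)).
  by move=> a t u; apply: hom_ext => h; rewrite /= /biduality_fun linearP.
rewrite -[@biduality _ _ _]/(linear_of bl : _ -> _).
apply: inj_surj_bij => [|h].
  apply: linear_inj => t t0; apply: tau_inj; rewrite linear0; apply: hom_ext => x.
  have evl : linear (fun t => tau t x) by move=> a u v; rewrite linearP.
  exact: (congr1 (fun g : hom (hom (tensor L C) C) C => g (linear_of evl)) t0).
have [K [i ip]] := kernel_exists p.
have [k [kb kE]] := kappa_exists ip.
(* Carried over to the syzygy of [M], the functional [h] extends to [P0] since Ext^1(M, C) = 0; the
   extension [psi] yields the preimage [sigma psi]. *)
have [psi psiE] := M_ext 0 _ _ _ _ P0_proj (conj ip p_surj) (h \o k).
exists (sigma psi); apply: hom_ext => g; have [y <-] := bij_surj kb g.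
have /fp[x xE] : p (i y) = 0 by apply/ip.2; exists y.
by rewrite /= /biduality_fun (kE _ x) // tau_sigma xE -[RHS]psiE.
Qed.

End GorensteinLinkage.

(** * Stability of [L] and horizontal linkage of [M] *)

Section Linked.
Variable R : comNzRingType.
Implicit Types P K L M N T : lmodType R.

Lemma stable_of_radical_dual L : finite_module L ->
  (forall (h : {linear L -> R^o}) l, in_radical (h l)) -> stable L.
Proof.
move=> Lf LJ; split=> // P Q Pp [g gb] x.
have gs : surjective (fst \o g : {linear L -> P}).
  by move=> y; have [l lE] := bij_surj gb (y, 0); exists l; rewrite /= lE.
have [n [y [a ya]]] := dual_basis_exists Pp (finite_surj gs Lf).
have zero_superfluous : superfluous (kernel (\0 : {linear P -> P})).
  apply: (superfluous_dual_basis ya) => i w _; have [l <-] := gs w.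
  exact: (LJ (a i \o (fst \o g) : {linear L -> R^o}) l).
apply/(kernelP (idfun : {linear P -> P})).
move: x; apply: zero_superfluous => x; exists 0, x; split; rewrite ?add0r //.
  exact: rpred0.
exact/kernelP.
Qed.

Lemma regular_faithful (r : R) : (forall c : R^o, r *: c = 0) -> r = 0.
Proof. by move=> /(_ 1) r0; rewrite -[r]mulr1. Qed.

Lemma regular_homothety (g : hom R^o R^o) : exists a : R, forall c, g c = a *: c.
Proof.
exists (g 1) => c; rewrite -[in LHS](mulr1 (c : R)).
by rewrite -[_ * _]/((c : R) *: (1 : R^o)) linearZ; exact: mulrC.
Qed.

Variables (M L P1 P0 : lmodType R) (f : {linear P1 -> P0}) (p : {linear P0 -> M}).
Variables (j : {linear L -> hom P1 R^o}) (r : {linear hom P0 R^o -> L}).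
Hypotheses (R_noetherian : noetherian R) (M_finite : finite_module M)
  (fp : minimal_presentation f p).
Hypotheses (j_inj : injective j) (r_surj : surjective r)
  (jr : forall phi, j (r phi) = hom_pre R^o f phi).
Hypothesis L_dual : forall h : {linear L -> R^o}, exists x, forall l, h l = j l x.

Lemma lambda_finite : finite_module L.
Proof.
have [_ P0p _ P0f] := minimal_presentation_finite R_noetherian M_finite fp.
exact: finite_surj r_surj (finite_dual P0p P0f).
Qed.

Lemma lambda_stable : stable L.
Proof.
apply: stable_of_radical_dual lambda_finite _ => h l.
have [x ->] := L_dual h; have [phi <-] := r_surj l; rewrite jr.
exact: minimal_presentation_radical fp.
Qed.

Let kernel_r phi : r phi = 0 <-> forall x, phi (f x) = 0.
Proof.
split=> [phi0 x|phi0].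
  by rewrite -[LHS]/(hom_pre R^o f phi x) -jr phi0 linear0.
by apply: j_inj; rewrite jr linear0; apply: hom_ext.
Qed.

(** A form in Ker [r] vanishes on the image of [f], so it factors through the stable module [M] and
    takes radical values. *)
Lemma dual_cover : semiperfect R -> stable M -> projective_cover r.
Proof.
move=> Rsp Ms.
have [_ P0p _ P0f] := minimal_presentation_finite R_noetherian M_finite fp.
split=> //; first exact: projective_dual.
have [n [x [a xa]]] := dual_basis_exists P0p P0f.
have [[_ p_surj _] _] := fp.
apply: (superfluous_dual xa) => phi /kernelP/kernel_r phi0 y.
have [z /(minimal_presentation_exact fp)[w <-] //|psi psiE] :=
  @factor_surj _ _ _ _ p phi p_surj.
by rewrite -psiE; exact: stable_radical.
Qed.

Lemma double_lambda : semiperfect R -> stable M ->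
  exists N, is_lambda L N /\ isomorphic M N.
Proof.
move=> Rsp Ms; have [[_ p_surj _] _] := fp.
have [_ P0p _ P0f] := minimal_presentation_finite R_noetherian M_finite fp.
(* Covering Ker [r] completes [r] to a minimal presentation of [L], from which the transpose of [L]
   and the module [N] are computed. *)
have Kf := finite_submodule (kernel r) R_noetherian (finite_dual P0p P0f).
have [Q [g gc]] := finite_projective_cover Rsp Kf; have [Qp g_surj _] := gc.
pose f' : {linear Q -> hom P0 R^o} := kernel_incl r \o g.
have fr : minimal_presentation f' r.
  split; first exact: dual_cover.
  by exists (submodule (kernel r)), (kernel_incl r), g; split=> //; exact: kernel_inclP.
have [I IP] := image_exists (hom_pre R^o f').
pose q : {linear hom Q R^o -> quotient I} := quotient_pi I.
have qc : is_cokernel (hom_pre R^o f') q.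
  split=> [y|y]; first exact: quotient_pi_surj.
  by rewrite -IP; have := quotient_piP I y 0; rewrite subr0 (linear0 q).
have [N [i iq]] := kernel_exists q.
exists N; split.
  exists (quotient I), (hom Q R^o), q, i; split=> //.
    by exists Q, (hom P0 R^o), f', r, q.
  exact: transpose_cover lambda_finite fr qc.
have el x : linear (fun z => f' z x).
  by move=> a y z; rewrite linearP.
have ell : linear (fun x => linear_of (el x) : hom Q R^o).
  by move=> a x y; apply: hom_ext => z /=; rewrite linearP.
have evl x : linear (fun phi : hom P0 R^o => phi x) by [].
(* [e] sends [x] to evaluation at [x] restricted along [f']. It is shown to have kernel Ker [p] and
   to be onto, so [M] is isomorphic to [N]. *)
have [x|e eE] := @factor_inj _ _ _ _ i (linear_of ell) iq.1.
  by apply/iq.2/qc.2; exists (linear_of (evl x)); apply: hom_ext.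
have e0 x : e x = 0 <-> p x = 0.
  split=> [ex0|/(minimal_presentation_exact fp)[y <-]]; last first.
    apply: iq.1; rewrite eE linear0; apply: hom_ext => z /=.
    have /kernel_r rz : r (f' z) = 0 by apply/(kernel_inclP r).2; exists (g z).
    exact: rz.
  (* If [e x = 0], every form in Ker [r] vanishes at [x], so evaluation at [x] descends to [L]. By
     [L_dual] it comes from some [y] in [P1], and [x = f y] because forms separate the points of
     [P0]. *)
  have [phi /(kernel_inclP r).2[k <-]|h hE] :=
      @factor_surj _ _ _ _ r (linear_of (evl x)) r_surj.
    have [z <-] := g_surj k.
    by rewrite -[LHS]/(linear_of ell x z) -eE ex0 linear0.
  have [y yE] := L_dual h; apply/(minimal_presentation_exact fp); exists y.
  apply/eqP; rewrite -subr_eq0; apply/eqP.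
  apply: (finite_hom_separates P0p P0f regular_faithful) => phi.
  by rewrite linearB -[phi x]/(linear_of (evl x) phi) -hE yE jr subrr.
have [x /e0 //|h hE] := @factor_surj _ _ _ _ p e p_surj.
exists h; apply: inj_surj_bij => [|y].
  by apply: linear_inj => m; have [x <-] := p_surj m; rewrite hE => /e0.
have /qc.2[theta thetaE] : q (i y) = 0 by apply/iq.2; exists y.
(* Reflexivity of [P0] over [R] turns [theta] into evaluation at a point. *)
have [x xE] := finite_hom_bidual theta P0p P0f regular_homothety.
exists (p x); rewrite hE; apply: iq.1; rewrite eE -thetaE.
by apply: hom_ext => z /=; rewrite xE.
Qed.
End Linked.

Theorem theorem5p6 (R : comNzRingType) (C M L : lmodType R)
    (R_noetherian : noetherian R) (R_semiperfect : semiperfect R)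
    (C_semidualizing : semidualizing C)
    (M_stable : stable M) (M_GCdim : GCdim_zero C M)
    (L_lambda : is_lambda M L) (L_auslander : auslander_class C L) :
  [/\ horizontally_linked M, stable L & GCdim_zero C (tensor L C)].
Proof.
have [C_finite C_homothety C_Ext] := C_semidualizing.
have [M_finite M_bidual M_Ext] := M_GCdim.
have [P1 [P0 [f [p [j [r [fp j_inj r_surj jr]]]]]]] :=
  lambda_embedding R_noetherian M_finite L_lambda.
have [[_ p_surj _] _] := fp.
have [_ P0p _ P0f] := minimal_presentation_finite R_noetherian M_finite fp.
have fp_exact := minimal_presentation_exact fp.
have C_faithful (a : R) : (forall c : C, a *: c = 0) -> a = 0.
  move=> aC; apply: (bij_inj C_homothety); apply: hom_ext => c.
  by rewrite /= /homothety_fun scale0r aC.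
have C_hom (h : hom C C) : exists a : R, forall c, h c = a *: c.
  by have [b _ bK] := C_homothety; exists (b h) => c; rewrite -[in LHS](bK h).
have C_ext n : ext_vanish C n C by apply/ext_zero_vanish/C_Ext.
have M_ext n : ext_vanish C n M by apply: ext_zero_vanish; case: (M_Ext n.+1).
have MC_ext n : ext_vanish C n (hom M C).
  by apply: ext_zero_vanish; case: (M_Ext n.+1).
have L_unit (h : hom C (tensor L C)) : exists l, forall c, h c = tens l c.
  by have [[b _ bK] _] := L_auslander; exists (b h) => c; rewrite -[in LHS](bK h).
have L_dual := lambda_dual C_finite C_faithful C_hom P0p P0f p_surj fp_exact
  M_bidual j_inj r_surj jr L_unit.
split.
- have [N [LN MN]] := double_lambda R_noetherian M_finite fp j_inj r_surj jr L_dual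
    R_semiperfect M_stable.
  by exists L, N.
- exact: lambda_stable R_noetherian M_finite fp r_surj jr L_dual.
split.
- exact: (lambda_tensor_finite C_finite C_faithful P0p P0f j_inj r_surj jr L_unit).
- exact: (lambda_tensor_bidual C_finite C_faithful C_hom P0p P0f p_surj fp_exact
    M_bidual M_ext j_inj r_surj jr L_unit).
(* Degree [n.+1] of [Ext_zero] corresponds to index [n] of [ext_vanish]. *)
case=> [//|n] _; split; apply: ext_vanish_zero.
- exact: (lambda_tensor_ext C_finite C_faithful C_ext P0p P0f p_surj fp_exact
    M_bidual MC_ext j_inj r_surj jr L_unit).
- exact: (hom_lambda_tensor_ext C_finite C_faithful C_hom P0p P0f p_surj fp_exact
    M_bidual M_ext j_inj r_surj jr L_unit).
Qed.
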